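(* Let $K$ be a compact metric space and let $(f_n)$ be a normalized Schauder basic sequence in $C(K)$. Suppose that there exist an infinite set $M\subset\mathbb{N}$ and a summable sequence of positive scalars $(\epsilon_n)$ such that for all $t\in K$ the set $\{n\in M:\ |f_n(t)|\ge \epsilon_n\}$ is finite. Then there exist an ordinal $\xi<\omega_1$ and a block basis of $\xi$-averages of $(f_n)$ which is equivalent to the unit vector basis of $c_0$.
   Context: $[M]$ denotes the set of infinite subsets of $M\subset\mathbb{N}$. $C(K)$ is the Banach space of scalar valued continuous functions on $K$ with the sup norm. Associated sequences: to every countable ordinal $\alpha\ge 1$ a sequence of successor ordinals $(\alpha_n+1)_{n}$ is associated once and for all: if $\alpha$ is a successor, $\alpha_n=\alpha-1$ for all $n$; if $\alpha$ is a limit ordinal, $(\alpha_n+1)$ is a (fixed) strictly increasing sequence of ordinals tending to $\alpha$. Blocks: for a normalized basic sequence $(e_n)$, a block is a nonzero finite linear combination $u=\sum a_ne_n$, with support $\mathrm{supp}\,u=\{n:a_n\neq0\}$; $u<v$ means $\max\mathrm{supp}\,u<\min\mathrm{supp}\,v$; a block basis is an infinite sequence of blocks $u_1<u_2<\cdots$. Transfinite averages: for a normalized basic sequence $(e_n)$, for $\alpha<\omega_1$ and $M\in[\mathbb{N}]$, normalized blocks $\alpha_1^M<\alpha_2^M<\cdots$ with $\bigcup_n\mathrm{supp}\,\alpha_n^M=M$ are defined by transfinite recursion on $\alpha$. If $\alpha=0$ and $M=\{m_1<m_2<\cdots\}$, then $\alpha_n^M=e_{m_n}$. If $\alpha=\beta+1$,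 then $\alpha_1^M=\big(\sum_{i=1}^{k}\beta_i^M\big)/\big\|\sum_{i=1}^{k}\beta_i^M\big\|$, where $k$ is the unique integer such that $\{\min\mathrm{supp}\,\beta_i^M: i\le k\}$ is a maximal (under inclusion) member of $S_1=\{F\subset\mathbb{N}: F \text{ finite}, |F|\le\min F\}\cup\{\emptyset\}$ (i.e. $k=\min M$). If $\alpha$ is a limit ordinal with associated sequence $(\alpha_n+1)$ and $m=\min M$, then $\alpha_1^M=e_1$ if $m=1$, and $\alpha_1^M=u/\|u\|$ with $u=\frac1m e_m+[\alpha_m]_1^{M\setminus\{m\}}$ if $m>1$. In the successor and limit cases, $\alpha_{n+1}^M=\alpha_1^{M_{n+1}}$, where $M_{n+1}=\{m\in M: m>\max\mathrm{supp}\,\alpha_n^M\}$. An $\alpha$-average of $(e_n)$ is any vector $\alpha_1^L$, $L\in[\mathbb{N}]$. A block basis of $\alpha$-averages is a block basis $u_1<u_2<\cdots$ all of whose terms are $\alpha$-averages. *)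

(* Defs.v *)
From HB Require Import structures.
From mathcomp Require Import all_boot all_order all_algebra.
From mathcomp Require Import all_classical all_reals all_analysis.
From mathcomp Require Import complex.
From mathcomp Require wochoice.

Set Implicit Arguments.
Unset Strict Implicit.
Unset Printing Implicit Defensive.

Import Order.TTheory GRing.Theory Num.Theory.
Import numFieldNormedType.Exports.

Local Open Scope classical_set_scope.
Local Open Scope ring_scope.

Variant scalar_kind := RealScalars | ComplexScalars.

Definition scalars (R : realType) (k : scalar_kind) : numFieldType :=
  if k is RealScalars then R else R[i].

Section scalars_sup.
Context {R : realType} {k : scalar_kind}.
Local Notation S := (scalars R k).

Lemma scalars_has_sup (A : set S) :
  A !=set0 -> (forall x, A x -> 0 <= x) -> ubound A !=set0 ->
  supremums A !=set0.
Proof.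
rewrite /scalars in A *; case: k A => A A0 Age0 [b Ab].
  exists (sup (A : set R)); split.
    by apply: (@sup_upper_bound R); split=> //; exists b.
  by move=> x Ax; exact: (@ge_sup R).
have AE x : A x -> x = (complex.Re x)%:C%C.
  by move=> /Age0; rewrite lecE/= => /andP[/eqP]; case: x => x y /= ->.
have bE : b = (complex.Re b)%:C%C.
  case: A0 => x Ax; have := le_trans (Age0 _ Ax) (Ab _ Ax).
  by rewrite lecE/= => /andP[/eqP]; case: b {Ab} => u v /= ->.
pose B := [set complex.Re x | x in A].
have B0 : B !=set0 by case: A0 => x Ax; exists (complex.Re x), x.
have hB : has_sup B.
  split=> //; exists (complex.Re b) => _ [x Ax <-].
  by have := Ab _ Ax; rewrite (AE _ Ax) bE lecR.
exists (sup B)%:C%C; split.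
  by move=> x Ax; rewrite (AE _ Ax) lecR; apply: sup_upper_bound => //; exists x.
move=> x Ax.
have xE : x = (complex.Re x)%:C%C.
  case: A0 => y Ay; have := le_trans (Age0 _ Ay) (Ax _ Ay).
  by rewrite lecE/= => /andP[/eqP]; case: x {Ax} => u v /= ->.
rewrite xE lecR; apply: ge_sup => // _ [y Ay <-].
by have := Ax _ Ay; rewrite (AE _ Ay) xE lecR.
Qed.

End scalars_sup.

Section compact_norm_bounded.
Context {S : numFieldType} {K : topologicalType}.

Lemma compact_norm_bounded (f : K -> S) : compact [set: K] -> continuous f ->
  exists2 M : S, 0 <= M & forall x, `|f x| <= M.
Proof.
move=> cK cf.
have : compact (range f).
  by apply: continuous_compact => //; exact: continuous_subspaceT.
rewrite compact_cover => /(_ S (range f) (fun y => (ball y 1)^°)).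
case=> [y _|y fy|D Df DT].
- exact: open_interior.
- by exists y => //; exact: nbhsx_ballx.
exists (\sum_(y <- finmap.enum_fset D) (`|y| + 1)).
  by apply: sumr_ge0 => x _; rewrite addr_ge0.
move=> x; have [y /= yD /interior_subset] := DT (f x) (ex_intro2 _ _ x I erefl).
rewrite -ball_normE /= => yfx.
rewrite (big_rem y)//= (@le_trans _ _ (`|y| + 1))//; last first.
  by rewrite lerDl; apply: sumr_ge0 => z _; rewrite addr_ge0.
rewrite -{1}(subrK y (f x)) addrC (le_trans (ler_normD _ _))// lerD2l.
by rewrite distrC ltW.
Qed.

End compact_norm_bounded.

(* C(K). The compactness proof is a parameter because the sup norm is a norm
   only on bounded functions. As everywhere in a normedModType, the norm takes
   its values in the scalar field itself; `supremum' is the least upper bound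
   for the (partial) order of that field. *)
Record CK (R : realType) (k : scalar_kind) (K : metricType R)
    (cK : compact [set: K]) := CK_of {
  CK_fun :> K -> scalars R k ;
  CK_continuous : continuous CK_fun }.
Arguments CK {R} k {K} cK.

HB.instance Definition _ (R : realType) (k : scalar_kind) (K : metricType R)
  (cK : compact [set: K]) := gen_eqMixin (CK k cK).
HB.instance Definition _ (R : realType) (k : scalar_kind) (K : metricType R)
  (cK : compact [set: K]) := gen_choiceMixin (CK k cK).

Section CK_theory.
Context {R : realType} {k : scalar_kind} {K : metricType R}.
Variable cK : compact [set: K].
Local Notation S := (scalars R k).
Local Notation C := (CK k cK).

Lemma CK_ext (f g : C) : f =1 g -> f = g.
Proof.
case: f g => [f cf] [g cg] /= /funext fg; rewrite fg in cf *.
by congr CK_of; exact: Prop_irrelevance.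
Qed.

Definition CK_zero : C := @CK_of R k K cK (fun=> 0) (fun=> cvg_cst _).
Definition CK_opp (f : C) : C :=
  @CK_of R k K cK (fun x => - f x) (fun x => cvgN (@CK_continuous _ _ _ _ f x)).
Definition CK_add (f g : C) : C :=
  @CK_of R k K cK (fun x => f x + g x)
    (fun x => cvgD (@CK_continuous _ _ _ _ f x) (@CK_continuous _ _ _ _ g x)).
Definition CK_scale (l : S) (f : C) : C :=
  @CK_of R k K cK (fun x => l * f x)
    (fun x => cvgM (cvg_cst l) (@CK_continuous _ _ _ _ f x)).

Lemma CK_addA : associative CK_add.
Proof. by move=> f g h; apply: CK_ext => x; exact: addrA. Qed.
Lemma CK_addC : commutative CK_add.
Proof. by move=> f g; apply: CK_ext => x; exact: addrC. Qed.
Lemma CK_add0 : left_id CK_zero CK_add.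
Proof. by move=> f; apply: CK_ext => x; exact: add0r. Qed.
Lemma CK_addN : left_inverse CK_zero CK_opp CK_add.
Proof. by move=> f; apply: CK_ext => x; exact: addNr. Qed.

HB.instance Definition _ :=
  GRing.isZmodule.Build C CK_addA CK_addC CK_add0 CK_addN.

Lemma CK_scaleA (a b : S) (f : C) :
  CK_scale a (CK_scale b f) = CK_scale (a * b) f.
Proof. by apply: CK_ext => x; exact: mulrA. Qed.
Lemma CK_scale1 : left_id 1 CK_scale.
Proof. by move=> f; apply: CK_ext => x; exact: mul1r. Qed.
Lemma CK_scaleDr : right_distributive CK_scale +%R.
Proof. by move=> a f g; apply: CK_ext => x; exact: mulrDr. Qed.
Lemma CK_scaleDl (f : C) : {morph CK_scale^~ f : a b / a + b}.
Proof. by move=> a b; apply: CK_ext => x; exact: mulrDl. Qed.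

HB.instance Definition _ := GRing.Zmodule_isLmodule.Build S C
  CK_scaleA CK_scale1 CK_scaleDr CK_scaleDl.

Lemma CK_addE (f g : C) x : (f + g) x = f x + g x. Proof. by []. Qed.
Lemma CK_oppE (f : C) x : (- f) x = - f x. Proof. by []. Qed.
Lemma CK_zeroE x : (0 : C) x = 0. Proof. by []. Qed.
Lemma CK_scaleE a (f : C) x : (a *: f) x = a * f x. Proof. by []. Qed.

Definition CK_norm (f : C) : S := supremum 0 [set `|f x| | x in [set: K]].

Lemma CK_norm_ub (f : C) x : `|f x| <= CK_norm f.
Proof.
have [M _ fM] := compact_norm_bounded cK (@CK_continuous _ _ _ _ f).
have [s fs] : supremums [set `|f y| | y in [set: K]] !=set0.
  apply: scalars_has_sup; first by exists `|f x|, x.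
    by move=> _ [y _ <-].
  by exists M => _ [y _ <-].
rewrite /CK_norm /supremum ifF; last first.
  by apply/negbTE/set0P; exists `|f x|, x.
by case: xgetP => [z _ [ub _]|/(_ s)//]; apply: ub; exists x.
Qed.

Lemma CK_norm_le (f : C) (M : S) : 0 <= M -> (forall x, `|f x| <= M) ->
  CK_norm f <= M.
Proof.
move=> M0 fM; rewrite /CK_norm /supremum; case: ifPn => // /set0P[_ [x0 _ _]].
case: xgetP => [z _ [_]|//]; apply=> _ [x _ <-]; exact: fM.
Qed.

Lemma CK_norm_ge0 (f : C) : 0 <= CK_norm f.
Proof.
rewrite /CK_norm /supremum; case: ifPn => // /set0P[_ [x _ _]].
case: xgetP => // z _ [ub _]; apply: (le_trans (normr_ge0 (f x))).
by apply: ub; exists x.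
Qed.

Lemma CK_normD (f g : C) : CK_norm (f + g) <= CK_norm f + CK_norm g.
Proof.
apply: CK_norm_le => [|x]; first by rewrite addr_ge0 ?CK_norm_ge0.
by rewrite (le_trans (ler_normD _ _))// lerD// CK_norm_ub.
Qed.

Lemma CK_normZ (l : S) (f : C) : CK_norm (l *: f) = `|l| * CK_norm f.
Proof.
have nZ a (g : C) : CK_norm (a *: g) <= `|a| * CK_norm g.
  apply: CK_norm_le => [|x]; first by rewrite mulr_ge0 ?CK_norm_ge0.
  by rewrite CK_scaleE normrM ler_wpM2l// CK_norm_ub.
apply/eqP; rewrite eq_le nZ/=; have [->|l0] := eqVneq l 0.
  by rewrite normr0 mul0r CK_norm_ge0.
rewrite -ler_pdivlMl ?normr_gt0// -normfV.
by apply: le_trans (nZ _ _); rewrite scalerA mulVf// scale1r.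
Qed.

Lemma CK_norm0_eq0 (f : C) : CK_norm f = 0 -> f = 0.
Proof.
move=> f0; apply: CK_ext => x; apply/eqP.
by rewrite CK_zeroE -normr_le0 -f0 CK_norm_ub.
Qed.

HB.instance Definition _ :=
  Lmodule_isNormed.Build S C CK_normD CK_normZ CK_norm0_eq0.

Lemma CK_normE (f : C) : `|f| = CK_norm f. Proof. by []. Qed.

End CK_theory.

Definition wo_set_nat : rel (set nat) :=
  sval (wochoice.well_ordering_principle (set nat)).

Lemma wo_min (A : set (set nat)) : A !=set0 ->
  exists2 x, A x & forall y, A y -> wo_set_nat x y.
Proof.
move=> [x Ax]; rewrite /wo_set_nat; case: wochoice.well_ordering_principle => /= r rP.
have [|z [[]]] := rP (fun x => x \in A); first by exists x; apply/mem_set.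
by move=> /set_mem Az zmin _; exists z => // y /mem_set; exact: zmin.
Qed.

Lemma wo_total : total wo_set_nat.
Proof.
move=> x y; have [|z] := @wo_min [set x; y]; first by exists x; left.
by move=> [->|->] zmin; apply/orP; [left|right]; apply: zmin; [right|left].
Qed.

Lemma wo_refl : reflexive wo_set_nat.
Proof. by move=> x; have /orP[] := wo_total x x. Qed.

Lemma wo_anti : antisymmetric wo_set_nat.
Proof.
move=> x y; rewrite /wo_set_nat; case: wochoice.well_ordering_principle => /= r rP.
move=> /andP[xy yx].
have rr z : r z z.
  have [|t [[tz tmin] _]] := rP (pred1 z); first by exists z; exact: eqxx.
  by move: tz tmin => /eqP-> /(_ z (eqxx _)).
have [|z [_ zu]] := rP (pred2 x y); first by exists x; rewrite inE eqxx.
have zx : z = x.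
  by apply: zu; split=> [|t]; rewrite inE ?eqxx// => /orP[]/eqP->.
have zy : z = y.
  by apply: zu; split=> [|t]; rewrite inE ?eqxx ?orbT// => /orP[]/eqP->.
by rewrite -zx.
Qed.

Lemma wo_trans : transitive wo_set_nat.
Proof.
move=> y x z xy yz; have [|t] := @wo_min [set u | u \in [:: x; y; z]].
  by exists x; rewrite /= mem_head.
rewrite /= !inE => /or3P[]/eqP-> tmin.
- by apply: tmin; rewrite !inE eqxx !orbT.
- have yx : wo_set_nat y x by apply: tmin; rewrite !inE eqxx.
  by rewrite (@wo_anti x y)// xy yx.
- have zx : wo_set_nat z x by apply: tmin; rewrite !inE eqxx.
  have zy : wo_set_nat z y by apply: tmin; rewrite !inE eqxx orbT.
  by have <- : y = z by apply: wo_anti; rewrite yz zy.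
Qed.

(* omega1 is the set of those points of a well-ordering of the uncountable set
   2^nat that have only countably many predecessors: a well-order
   (omega1_wf) that is uncountable (omega1_uncountable) while all its initial
   segments are countable (omega1_countable_below), i.e. the ordinals below
   omega_1. *)
Definition omega1 := {x : set nat | `[< countable [set y | wo_set_nat y x] >]}.

HB.instance Definition _ := Choice.on omega1.

Fact omega1_display : Order.disp_t. Proof. exact: Order.default_display. Qed.

Definition omega1_le (x y : omega1) := wo_set_nat (val x) (val y).

Fact omega1_le_refl : reflexive omega1_le.
Proof. by move=> x; exact: wo_refl. Qed.
Fact omega1_le_anti : antisymmetric omega1_le.
Proof. by move=> x y xy; apply/val_inj/wo_anti. Qed.
Fact omega1_le_trans : transitive omega1_le.
Proof. by move=> y x z; exact: wo_trans. Qed.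

HB.instance Definition _ := Order.Le_isPOrder.Build omega1_display omega1
  omega1_le_refl omega1_le_anti omega1_le_trans.

Fact omega1_le_total : total (<=%O : rel omega1).
Proof. by move=> x y; exact: wo_total. Qed.

HB.instance Definition _ :=
  Order.POrder_isTotal.Build omega1_display omega1 omega1_le_total.

Lemma omega1_min (A : set omega1) : A !=set0 ->
  exists2 x, A x & forall y, A y -> (x <= y)%O.
Proof.
move=> [x Ax]; have [|z] := @wo_min (val @` A); first by exists (val x), x.
by move=> [y Ay <-] ymin; exists y => // t At; apply: ymin; exists t.
Qed.

Lemma omega1_wf : well_founded (fun x y : omega1 => (x < y)%O).
Proof.
move=> x; apply: contrapT => xN.
have [|y yN ymin] := @omega1_min [set y | ~ Acc (fun x y : omega1 => (x < y)%O) y].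
  by exists x.
apply: yN; constructor=> z zy; apply: contrapT => zN.
by have := ymin _ zN; rewrite leNgt zy.
Qed.

Lemma omega1_countable_below (x : omega1) : countable [set y | (y <= x)%O].
Proof.
have /asboolP := valP x; apply: sub_countable.
rewrite -(card_le_eql (inj_card_eq (in2W val_inj))).
by apply: subset_card_le => _ [y yx <-].
Qed.

Lemma set_nat_uncountable : ~ countable [set: set nat].
Proof.
move=> /countable_injP[f finj].
pose D := [set n | exists2 X : set nat, f X = n & ~ X n].
have DN : ~ D (f D).
  by move=> DD; case: (DD) => X /finj XD; rewrite XD ?inE// in DD *.
by apply: (DN); exists D.
Qed.

Lemma omega1_uncountable : ~ countable [set: omega1].
Proof.
move=> cW; pose A := val @` [set: omega1].
have cA : countable A by rewrite /countable (card_le_trans (card_image_le _ _)).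
have [AT|/existsNP[z Az]] := pselect (forall x, A x).
  by apply: set_nat_uncountable; rewrite (_ : setT = A)//; apply/seteqP; split.
have [|t At tmin] := @wo_min (~` A); first by exists z.
apply: At; suff ct : `[< countable [set y | wo_set_nat y t] >] by exists (exist _ t ct).
apply/asboolP/(@sub_countable _ _ _ (A `|` [set t])); last first.
  rewrite -bigcup2E; apply: bigcup_countable => //.
  by move=> [|[|n]] _ /=; [exact: cA|exact: countable1|exact: countable0].
apply: subset_card_le => y yt; have [?|/tmin ty] := pselect (A y); first by left.
by right; apply: wo_anti; rewrite yt ty.
Qed.

Definition is_succ (b a : omega1) :=
  (b < a)%O /\ forall c, (b < c)%O -> (a <= c)%O.

Definition is_zero (a : omega1) := forall b, (a <= b)%O.

Definition is_limit (a : omega1) := ~ is_zero a /\ forall b, ~ is_succ b a.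

Definition osucc (b : omega1) : omega1 := xget b [set a | is_succ b a].

Definition opred (a : omega1) : omega1 := xget a [set b | is_succ b a].

Lemma osuccP b : is_succ b (osucc b).
Proof.
rewrite /osucc; case: xgetP => // /(_ _)/= bN.
have [|a ba amin] := @omega1_min [set a | (b < a)%O]; last first.
  by exfalso; exact: (bN a).
apply: contrapT => /forallNP bmax; apply: omega1_uncountable.
apply: sub_countable (omega1_countable_below b); apply: subset_card_le => c _ /=.
by rewrite leNgt; apply/negP/bmax.
Qed.

Lemma is_succ_inj b c a : is_succ b a -> is_succ c a -> b = c.
Proof.
move=> [ba bm] [ca cm]; apply/eqP; rewrite eq_le !leNgt; apply/andP; split.
  by apply/negP => /cm; rewrite leNgt ba.
by apply/negP => /bm; rewrite leNgt ca.
Qed.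

Lemma opredE b a : is_succ b a -> opred a = b.
Proof.
move=> ba; rewrite /opred; case: xgetP => [c _ ca|/(_ b)//].
exact: is_succ_inj ca ba.
Qed.

(* Here and below all sequences are indexed from 0: the natural number j stands
   for the positive integer j+1. So s a j is alpha_{j+1}, e j is e_{j+1}, and
   a set M : set nat stands for {j+1 | j in M}. The value of s at the zero
   ordinal is irrelevant. *)
Definition associated_sequences (s : omega1 -> nat -> omega1) :=
  (forall b a, is_succ b a -> forall n, s a n = b) /\
  (forall a, is_limit a ->
    [/\ forall m n, (m < n)%N -> (osucc (s a m) < osucc (s a n))%O,
        forall n, (osucc (s a n) < a)%O &
        forall b, (b < a)%O -> exists n, (b < osucc (s a n))%O]).

(* Finite linear combinations of (e_n) are represented by their coefficients, as
   polynomials: 'X^n stands for the vector e n, and p for lincomb e p. The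
   coefficients are determined by the vector when (e_n) is basic. *)
Section averages.
Context {S : numFieldType} {V : normedModType S}.
Variables (s : omega1 -> nat -> omega1) (e : nat -> V).

Definition lincomb (p : {poly S}) : V := \sum_(i < size p) p`_i *: e i.

Definition supp (p : {poly S}) : set nat := [set i | p`_i != 0].

Definition unitize (p : {poly S}) : {poly S} := `|lincomb p|^-1 *: p.

Definition minelt (M : set nat) : nat :=
  xget 0%N [set m | M m /\ forall l, M l -> (m <= l)%N].

Definition nthelt (M : set nat) (n : nat) : nat :=
  minelt (iter n (fun L => L `\ minelt L) M).

Definition beyond (M : set nat) (p : {poly S}) : set nat :=
  [set m | M m /\ forall i, supp p i -> (i < m)%N].

(* Given the map M |-> alpha_1^M, tailset first M n is M_{n+1}. *)
Fixpoint tailset (first : set nat -> {poly S}) (M : set nat) (n : nat) :=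
  if n is n'.+1 then beyond M (first (tailset first M n')) else M.

Definition consecutive (first : set nat -> {poly S}) (M : set nat) (n : nat) :=
  first (tailset first M n).

(* {min supp beta_i^M | i <= k} is a maximal set F with |F| <= min F exactly when
   k is the integer min M, i.e. (minelt M).+1. *)
Definition avg_succ (prev : set nat -> nat -> {poly S}) (M : set nat) :=
  unitize (\sum_(i < (minelt M).+1) prev M i).

(* With m := minelt M, the integer min M is m.+1, and prev m gives the blocks of
   the ordinal alpha_{m+1} = s alpha m. *)
Definition avg_limit (prev : nat -> set nat -> nat -> {poly S}) (M : set nat) :=
  let m := minelt M in
  if m == 0%N then 'X^0
  else unitize (m.+1%:R^-1 *: 'X^m + prev m (M `\ m) 0%N).

Definition avg_step (a : omega1) (rec : omega1 -> set nat -> nat -> {poly S}) :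
    set nat -> nat -> {poly S} :=
  if `[< is_zero a >] then fun M n => 'X^(nthelt M n)
  else if `[< is_limit a >] then
    consecutive (avg_limit (fun m => rec (s a m)))
  else consecutive (avg_succ (rec (opred a))).

(* avg a M n is alpha_{n+1}^M; the guard on b < a is discharged in avg_osucc
   and avg_is_limit. *)
Definition avg : omega1 -> set nat -> nat -> {poly S} :=
  Fix omega1_wf (fun=> set nat -> nat -> {poly S}) (fun a rec =>
    avg_step a (fun b => if pselect (b < a)%O is left ba then rec b ba
                         else fun _ _ => 0)).

Lemma avg_unfold a :
  avg a = avg_step a (fun b => if (b < a)%O then avg b else fun _ _ => 0).
Proof.
rewrite {1}/avg Fix_eq; last first.
  move=> x f g fg; congr avg_step; apply/funext => b.
  by case: pselect.
by congr avg_step; apply/funext => b; case: pselect => [->//|/negP/negbTE ->].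
Qed.

Lemma avg_zero a : is_zero a -> avg a = fun M n => 'X^(nthelt M n).
Proof. by move=> a0; rewrite avg_unfold /avg_step asboolT. Qed.

Lemma avg_osucc b : avg (osucc b) = consecutive (avg_succ (avg b)).
Proof.
have ba := osuccP b; rewrite avg_unfold /avg_step.
rewrite asboolF => [|/(_ b)]; last by rewrite leNgt ba.1.
by rewrite asboolF => [|[_ /(_ b)]//]; rewrite (opredE ba) ba.1.
Qed.

Lemma avg_is_limit a : associated_sequences s -> is_limit a ->
  avg a = consecutive (avg_limit (fun m => avg (s a m))).
Proof.
move=> [_ sl] al; rewrite avg_unfold /avg_step.
rewrite (asboolF al.1) asboolT//; congr consecutive; congr avg_limit.
apply/funext => m; have [_ + _] := sl _ al => /(_ m) sa.
by rewrite (lt_trans (osuccP _).1 sa).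
Qed.

Definition average_of a (p : {poly S}) :=
  exists2 L : set nat, infinite_set L & p = avg a L 0%N.

Definition block_lt (p q : {poly S}) :=
  forall i j, supp p i -> supp q j -> (i < j)%N.

Definition block_basis (p : nat -> {poly S}) :=
  (forall n, p n != 0) /\ forall n, block_lt (p n) (p n.+1).

Definition normalized_seq (e : nat -> V) := forall n, `|e n| = 1.

Definition lin_span : set V :=
  [set x | exists (n : nat) (c : nat -> S), x = \sum_(i < n) c i *: e i].

(* A Schauder basis of its closed linear span. *)
Definition basic_seq := forall x, closure lin_span x ->
  exists! c : nat -> S, series (fun n => c n *: e n) @ \oo --> x.

(* The maximum is the c_0-norm of the combination of the unit vectors with
   coefficients x 0, .., x (n-1). *)
Definition equivalent_c0 (u : nat -> V) :=
  exists c C : S, [/\ 0 < c, 0 < C & forall (n : nat) (x : nat -> S),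
    c * \big[Order.max/0]_(i < n) `|x i| <= `|\sum_(i < n) x i *: u i|
      <= C * \big[Order.max/0]_(i < n) `|x i|].
End averages.

Lemma associated_sequences_exists : exists s, associated_sequences s.
Proof.
suff H a : {t : nat -> omega1 | (forall b, is_succ b a -> forall n, t n = b) /\
  (is_limit a ->
    [/\ forall m n, (m < n)%N -> (osucc (t m) < osucc (t n))%O,
        forall n, (osucc (t n) < a)%O &
        forall b, (b < a)%O -> exists n, (b < osucc (t n))%O])}.
  by exists (fun a => sval (H a)); split=> [b a|a]; case: (svalP (H a)) => // + _; exact.
apply: cid; have [al|aN] := pselect (is_limit a); last first.
  by exists (fun=> opred a); split=> // b ba n; exact: opredE.
have osb b : (b < a)%O -> (osucc b < a)%O.
  move=> ba; rewrite lt_neqAle (osuccP b).2// andbT; apply/eqP => oa.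
  by case: al => _ /(_ b); rewrite -oa; apply; exact: osuccP.
have os_mono b c : (b < c)%O -> (osucc b < osucc c)%O.
  by move=> bc; rewrite (le_lt_trans ((osuccP b).2 _ bc))//; case: (osuccP c).
have [z za] : exists z, (z < a)%O.
  apply: contrapT => /forallNP aN; apply: al.1 => b.
  by rewrite leNgt; apply/negP/aN.
have /countable_injP[f finj] := omega1_countable_below a.
pose g n := xget z [set b | (b < a)%O /\ f b = n].
have ga n : (g n < a)%O by rewrite /g; case: xgetP => [b _ []|_].
have gf b : (b < a)%O -> g (f b) = b.
  move=> ba; rewrite /g; case: xgetP => [c _ [ca /finj]|/(_ b)]; last first.
    by case; split.
  by apply; rewrite inE /= ltW.
pose t := fix t n := if n is n'.+1 then Order.max (osucc (t n')) (g n) else g 0%N.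
have ta n : (t n < a)%O.
  by elim: n => [|n IH]; rewrite ?ga//= gt_max osb// ga.
have tS n : (t n < t n.+1)%O by rewrite /= lt_max (osuccP _).1.
have gt n : (g n <= t n)%O by case: n => [|n] //=; rewrite le_max lexx orbT.
exists t; split=> [b /al.2//|_]; split.
- move=> m n mn; apply: os_mono; elim: n mn => // n IH.
  rewrite ltnS leq_eqVlt => /predU1P[->//|/IH tmn]; exact: lt_trans tmn (tS n).
- by move=> n; exact: osb.
- move=> b ba; exists (f b); rewrite -{1}(gf _ ba).
  by rewrite (le_lt_trans (gt _))//; case: (osuccP (t (f b))).
Qed.

(* Main.v *)
Require Import Defs.
From HB Require Import structures.
From mathcomp Require Import all_boot all_order all_algebra.
From mathcomp Require Import all_classical all_reals all_analysis.
From mathcomp Require Import complex zify ring lra.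

Set Implicit Arguments.
Unset Strict Implicit.
Unset Printing Implicit Defensive.

Import Order.TTheory GRing.Theory Num.Theory.
Import numFieldNormedType.Exports.

Local Open Scope classical_set_scope.
Local Open Scope ring_scope.

(* For a finite set s of indices let K_s be the set of the points t with
   |f_n(t)| >= eps_n for all n in s. By compactness the sets s with K_s nonempty
   form a well-founded tree. On a sparse subset of M the sequence (f_n) is basic,
   with basis constant tending to 1 on tails; all averages are taken there.

   Let nu(a, L) be the norm of the sum of the first min L many a-averages of L.
   Suppose first that nu(a, L) >= 1 + eta can be achieved for all L in [N],
   beyond any given ordinal and infinite set. By induction on the tree, the
   a-averages then become uniformly small on K_s: at a point t of K_s, a sum of
   consecutive averages is dominated by the single one whose support contains
   the first n with t in K_{s,n}, the later ones being small by the induction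
   hypothesis and the earlier ones by the summability of (eps_n). Dividing by nu
   gains a factor 1/(1 + eta), and smallness persists through all larger
   ordinals. For the root this contradicts normalization.

   So, by the Ramsey property of open sets of infinite subsets of N, there are an
   ordinal a1 and an infinite set such that nu(b, .) is at most 1 + eta on a
   dense family of sets, for all b >= a1 and all eta > 0. Consider the sequences
   (v_j) of a1-averages for which some initial segment has, at some point, all
   real (or imaginary) parts of the same sign and a sum of absolute value greater
   than 8. If all sequences in some infinite set were of this kind, they would
   form a well-founded tree, of rank smaller than some ordinal b; but a b-average
   is, up to a small error, a combination of a1-averages with coefficients close
   to 1, and for large b it contains such an initial segment, so that its norm is
   too large. By the Ramsey property no sequence in some infinite set is of this
   kind, whence sup_t sum_j |v_j(t)| <= 32 there and (v_j) is equivalent to the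
   unit vector basis of c_0. *)

(** * Dependent choice with an invariant at each stage *)

Lemma dependent_choice_in (T : Type) (P : nat -> T -> Prop)
    (Q : nat -> T -> T -> Prop) (x0 : T) : P 0%N x0 ->
  (forall n x, P n x -> exists y, P n.+1 y /\ Q n x y) ->
  exists u : nat -> T, u 0%N = x0 /\
    forall n, P n (u n) /\ Q n (u n) (u n.+1).
Proof.
move=> Px0 PQ.
have g n (x : {x | P n x}) : {y : {y | P n.+1 y} | Q n (sval x) (sval y)}.
  by case: x => x Px; case: (cid (PQ n x Px)) => y [Py Qy]; exists (exist _ y Py).
pose w := fix w n : {x | P n x} :=
  if n is n'.+1 then sval (g n' (w n')) else exist _ x0 Px0.
exists (fun n => sval (w n)); split=> // n; split; first exact: svalP (w n).
exact: svalP (g n (w n)).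
Qed.

(** * Infinite sets of natural numbers *)

Definition unbounded (L : set nat) := forall n, exists2 m, (n <= m)%N & L m.

Lemma infinite_unbounded (L : set nat) : infinite_set L <-> unbounded L.
Proof.
split=> [iL n|uL /finite_seqP[s sL]].
  apply: contrapT => nL; apply: iL; apply: (sub_finite_set _ (finite_II n)).
  move=> m Lm /=; rewrite ltnNge; apply/negP => nm; apply: nL; by exists m.
have [m sm] := uL (\max_(i <- s) i).+1; rewrite sL /= => ms.
by have := @leq_bigmax_seq _ s xpredT id m ms isT; rewrite leqNgt sm.
Qed.

(** The relation $L\in[N]$, with infinity of [L] expressed as unboundedness. *)
Definition infsub (L N : set nat) := L `<=` N /\ unbounded L.

Definition above (L : set nat) (n : nat) : set nat :=
  [set m | L m /\ (n <= m)%N].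

Lemma unbounded_sub (L L' : set nat) : L `<=` L' -> unbounded L -> unbounded L'.
Proof. by move=> LL uL n; have [m nm /LL Lm] := uL n; exists m. Qed.

Lemma unbounded_above L n : unbounded L -> unbounded (above L n).
Proof.
move=> uL k; have [m] := uL (maxn k n); rewrite geq_max => /andP[km nm] Lm.
by exists m.
Qed.

Lemma infsub_refl L : unbounded L -> infsub L L. Proof. by split. Qed.

Lemma infsub_trans L L' N : infsub L L' -> infsub L' N -> infsub L N.
Proof. by move=> [LL' uL] [LN _]; split=> // x /LL'/LN. Qed.

Lemma infsub_above L n : unbounded L -> infsub (above L n) L.
Proof. by move=> uL; split; [move=> x []|exact: unbounded_above]. Qed.

Lemma mineltP L : unbounded L -> L (minelt L) /\ forall l, L l -> (minelt L <= l)%N.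
Proof.
move=> /(_ 0%N)[m _ Lm]; rewrite /minelt; case: xgetP => // /(_ _) nL.
have exL : exists m, `[< L m >] by exists m; apply/asboolP.
have [n /asboolP Ln nmin] := ex_minnP exL.
by case: (nL n); split=> // l Ll; apply: nmin; apply/asboolP.
Qed.

Lemma minelt_eq L m : L m -> (forall l, L l -> (m <= l)%N) -> minelt L = m.
Proof.
move=> Lm mL; rewrite /minelt; case: xgetP => [n _ [Ln nL]|/(_ m)[]//].
by apply/eqP; rewrite eqn_leq nL// mL.
Qed.

(** The elements of [L] are picked one by one, the one after [x] inside [N x.+1]; since the sets
    decrease, everything after [x] lies in [N x.+1]. *)
Lemma pseudo_intersection (N : nat -> set nat) : (forall j, unbounded (N j)) ->
  (forall j, N j.+1 `<=` N j) ->
  exists2 L, infsub L (N 0%N) &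
    forall m, L m -> above L m.+1 `<=` N m.+1.
Proof.
move=> uN dN.
have dec i j : (i <= j)%N -> N j `<=` N i.
  by move/subnK <-; elim: (j - i)%N => // k IH x /dN/IH.
have [x0 _ Nx0] := uN 0%N 0%N.
have [] := @dependent_choice_in nat (fun=> N 0%N)
    (fun _ x y => (x < y)%N /\ N x.+1 y) x0 Nx0.
  move=> _ x _; have [y xy Ny] := uN x.+1 x.+1; exists y; split=> //.
  exact: dec Ny.
move=> u [_ uP]; have u_lt n : (u n < u n.+1)%N by have [_ []] := uP n.
have u_mono : {homo u : i j / (i < j)%N} by apply: homo_ltn => //; exact: ltn_trans.
have u_ge n : (n <= u n)%N by elim: n => // n IH; exact: leq_ltn_trans (u_lt n).
exists (range u).
  split; first by move=> _ [n _ <-]; case: (uP n).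
  by move=> n; exists (u n) => //; exists n.
move=> _ [i _ <-] _ [[j _ <-] ij].
have {}ij : (i < j)%N.
  rewrite ltnNge; apply/negP; rewrite leq_eqVlt => /predU1P[ji|/u_mono ji].
    by rewrite ji ltnn in ij.
  by have := ltn_trans ij ji; rewrite ltnn.
case: j ij => // j ij; have [_ [_ Nj]] := uP j; apply: dec Nj.
by move: ij; rewrite ltnS [in X in X -> _]leq_eqVlt => /predU1P[->//|/u_mono/ltnW].
Qed.

(** Sets satisfying [D 0], [D 1], ... are chosen one inside the other, and a pseudo-intersection is
    taken. This is the tool for meeting countably many dense requirements on one infinite set, the
    n-th of them only beyond elements that are at least [n]. *)
Lemma diagonal_dense (D : nat -> set nat -> Prop) (N : set nat) : unbounded N ->
  (forall n L L', infsub L' L -> D n L -> D n L') ->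
  (forall n L, infsub L N -> exists2 L', infsub L' L & D n L') ->
  exists2 L, infsub L N & forall m, L m -> forall n, (n <= m)%N ->
    D n (above L m.+1).
Proof.
move=> uN hD dD.
have [] := @dependent_choice_in (set nat) (fun _ L => infsub L N)
  (fun n L L' => infsub L' L /\ D n L') N (infsub_refl uN).
  move=> n L LN; have [L' L'L DL'] := dD n L LN; exists L'; split=> //.
  exact: infsub_trans LN.
move=> u [u0 uP].
have [||L LN LP] := @pseudo_intersection u; first by move=> j; case: (uP j) => -[].
  by move=> j; case: (uP j) => _ [[]].
rewrite u0 in LN; exists L => // m Lm n nm.
have dec : u m.+1 `<=` u n.+1.
  move: nm; rewrite -ltnS => /subnK <-; elim: (m.+1 - n.+1)%N => // k IH x.
  by case: (uP (k + n.+1)%N) => _ [[+ _] _] => /[apply]; exact: IH.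
case: (uP n) => _ [_]; apply: hD; split.
  by apply: (subset_trans _ dec); exact: LP.
by apply: unbounded_above; case: LN.
Qed.

(** * Open sets are Ramsey *)

Fixpoint sublists (l : seq nat) : seq (seq nat) :=
  if l is x :: l' then map (cons x) (sublists l') ++ sublists l' else [:: [::]].

Lemma mem_sublists s l : (s \in sublists l) = subseq s l.
Proof.
elim: l s => [|x l IH] [|y s] //=; rewrite mem_cat IH.
  by rewrite sub0seq orbT.
case: eqVneq => [->|yx].
  rewrite mem_map ?IH; last by move=> ? ? [].
  by apply/orb_idr => /(subseq_trans (subseq_cons _ _)).
rewrite -[RHS]orFb; congr orb; apply/negbTE/mapP => -[s' _ [/eqP]].
by rewrite (negbTE yx).
Qed.

Section Ramsey.
Variables (U : set nat -> Prop) (N : set nat).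

(** Combinatorial forcing in the style of Galvin and Prikry: [s] is a finite beginning and [L] the
    reservoir for the rest. Acceptance means that all continuations of [s] from the reservoir lie in
    [U], rejection that no smaller reservoir accepts. *)
Let glue (s : seq nat) (L : set nat) : set nat := [set x | (x \in s) \/ L x].
Let accepts (L : set nat) (s : seq nat) := forall L', infsub L' L ->
  (forall x y, x \in s -> L' y -> (x < y)%N) -> U (glue s L').
Let rejects (L : set nat) (s : seq nat) := forall L', infsub L' L -> ~ accepts L' s.

Let accepts_sub L L' s : infsub L' L -> accepts L s -> accepts L' s.
Proof. by move=> L'L aL L'' L''L'; apply: aL; exact: infsub_trans L'L. Qed.

Let rejects_sub L L' s : infsub L' L -> rejects L s -> rejects L' s.
Proof. by move=> L'L rL L'' L''L'; apply: rL; exact: infsub_trans L'L. Qed.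

Let decides L s := accepts L s \/ rejects L s.

Let decides_sub L L' s : infsub L' L -> decides L s -> decides L' s.
Proof.
by move=> L'L [/(accepts_sub L'L) aL|/(rejects_sub L'L) rL]; [left|right].
Qed.

Let decide1 L s : unbounded L -> exists2 L', infsub L' L & decides L' s.
Proof.
move=> uL; have [[L' L'L aL']|nL] := pselect (exists2 L', infsub L' L & accepts L' s).
  by exists L' => //; left.
exists L; first exact: infsub_refl.
by right=> L' L'L aL'; apply: nL; exists L'.
Qed.

Let decide_seq L (ss : seq (seq nat)) : unbounded L ->
  exists2 L', infsub L' L & forall s, s \in ss -> decides L' s.
Proof.
move=> uL; elim: ss => [|s ss [L1 L1L dL1]].
  by exists L => //; exact: infsub_refl.
have [|L2 L2L1 dL2] := @decide1 L1 s; first by case: L1L.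
exists L2; first exact: infsub_trans L1L.
move=> s'; rewrite inE => /predU1P[->//|/dL1]; exact: decides_sub.
Qed.

Let glue_rcons s y (L : set nat) : L y -> unbounded L ->
  (forall l, L l -> (y <= l)%N) ->
  glue s L = glue (rcons s y) (above L y.+1).
Proof.
move=> Ly uL yL; apply/seteqP; split=> x /=; rewrite /glue /above /= mem_rcons inE.
  move=> [->|Lx]; first by left; rewrite orbT.
  have [->|xy] := eqVneq x y; first by left.
  by right; split=> //; have := yL x Lx; lia.
by move=> [/predU1P[->|xs]|[Lx _]]; [right|left|right].
Qed.

(** If [rcons s y] were accepted for infinitely many [y] in [L], the set of these [y] would accept
    [s]: a continuation of [s] inside it continues [rcons s y] for its own least element [y]. So it
    is enough to remove an initial part of [L]. *)
Let reject_extend L N1 s n : infsub L N1 ->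
  (forall y, N1 y -> (n < y)%N -> decides N1 (rcons s y)) -> rejects N1 s ->
  exists2 L', infsub L' L & forall y, L' y -> rejects N1 (rcons s y).
Proof.
move=> LN1 dL rL; have uL := LN1.2.
pose Z := [set y | above L n.+1 y /\ accepts N1 (rcons s y)].
have [uZ|nZ] := pselect (unbounded Z).
  case: (rL Z); first by split=> // y [[/LN1.1]].
  move=> L' L'Z sL'; have [mL' L'm] := mineltP L'Z.2.
  rewrite (glue_rcons _ mL')//; last by case: L'Z.
  have [_ ac] := L'Z.1 _ mL'; apply: ac.
    by split; [move=> x [/L'Z.1[[/LN1.1]]]|apply: unbounded_above; case: L'Z].
  move=> x y; rewrite mem_rcons inE => /predU1P[->|xs] [L'y my] //.
  exact: sL'.
have [k kZ] : exists k, forall m, (k <= m)%N -> ~ Z m.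
  apply: contrapT => nk; apply: nZ => k; apply: contrapT => kk; apply: nk.
  by exists k => m km Zm; apply: kk; exists m.
exists (above (above L n.+1) k).
  apply: (@infsub_trans _ (above L n.+1)); last exact: infsub_above.
  exact/infsub_above/unbounded_above.
move=> y [[Ly ny] ky]; have [ac|//] := dL y (LN1.1 _ Ly) ny.
by case: (kZ y ky).
Qed.

Lemma open_Ramsey : unbounded N ->
  (forall L, infsub L N -> U L -> exists n, forall L', infsub L' N ->
    (forall x, (x < n)%N -> L x <-> L' x) -> U L') ->
  exists2 L, infsub L N & (forall L', infsub L' L -> U L') \/
                          (forall L', infsub L' L -> ~ U L').
Proof.
move=> uN oU; have [N0 N0N [aN0|rN0]] := decide1 [::] uN.
  exists N0 => //; left=> L' L'N0; have := aN0 L' L'N0.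
  by rewrite (_ : glue _ _ = L')//; [exact|apply/seteqP; split=> x /=; [case|right]].
have uN0 := N0N.2.
(* For [m] in [N1], the part of [N1] beyond [m] decides all subsets of $\{0,\dots,m\}$. *)
have [||N1 N1N0 dN1] := @diagonal_dense
  (fun n L => forall s, s \in sublists (iota 0 n.+1) -> decides L s) N0 uN0.
- by move=> n L L' L'L dL s /dL; exact: decides_sub.
- by move=> n L [_ uL]; exact: decide_seq.
have uN1 := N1N0.2.
(* Decisions pass from the part of [N1] beyond [y] to [N1] itself, since a continuation of
   [rcons s y] uses only elements larger than [y]. *)
have dec1 s n y : s \in sublists (iota 0 n.+1) -> N1 y -> (n < y)%N ->
    decides N1 (rcons s y).
  rewrite mem_sublists => sn Ny ny.
  have [|aL|rL] := dN1 y Ny y (leqnn y) (rcons s y).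
  - rewrite mem_sublists -cats1 -addn1 iotaD cat_subseq//.
    by rewrite (subseq_trans sn)// -(subnKC ny) iotaD prefix_subseq.
  - left=> L' L'N1 sL'; apply: aL => //; split; last by case: L'N1.
    move=> x L'x; split; first exact: L'N1.1.
    by apply: sL' L'x; rewrite mem_rcons mem_head.
  - right=> L' L'N1 aL'.
    have L'y : infsub (above L' y.+1) L' by apply: infsub_above; case: L'N1.
    apply: (rL (above L' y.+1)); last exact: accepts_sub aL'.
    split; last by case: L'y.
    by move=> x [/L'N1.1 N1x yx].
(* A second diagonalization makes rejection hereditary: extending a rejected set by a later element
   of [N2] gives a rejected set. *)
have [||N2 N2N1 rN2] := @diagonal_dense
  (fun n L => forall s, s \in sublists (iota 0 n.+1) -> rejects N1 s ->
     forall y, L y -> rejects N1 (rcons s y)) N1 uN1.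
- by move=> n L L' [L'L _] rL s sn rs y /L'L; exact: rL.
- move=> n L LN1.
  suff: forall ss : seq (seq nat), {subset ss <= sublists (iota 0 n.+1)} ->
      exists2 L', infsub L' L & forall s, s \in ss -> rejects N1 s ->
        forall y, L' y -> rejects N1 (rcons s y) by apply.
  elim=> [_|s ss IH sub]; first by exists L => //; apply: infsub_refl; case: LN1.
  have [|L1 L1L rL1] := IH; first by move=> s' s's; apply: sub; rewrite inE s's orbT.
  have [rs|nrs] := pselect (rejects N1 s); last first.
    exists L1 => // s'; rewrite inE => /predU1P[->//|]; exact: rL1.
  have L1N1 := infsub_trans L1L LN1.
  have [||L2 L2L1 rL2] := @reject_extend L1 N1 s n L1N1; first 2 last.
  - exists L2; first exact: infsub_trans L1L.
    move=> s'; rewrite inE => /predU1P[->//|s'ss rs' y /L2L1.1]; exact: rL1.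
  - by move=> y N1y ny; apply: (dec1 s n) => //; apply: sub; rewrite mem_head.
  - exact: rs.
have [N2m mN2] := mineltP N2N1.2.
(* The least element of [N2] is dropped so that it can serve as the bound [m] for the empty initial
   segment in the induction below. *)
exists (above N2 (minelt N2).+1).
  apply: (infsub_trans (infsub_above _ N2N1.2)).
  exact: infsub_trans (infsub_trans N1N0 N0N).
right=> L LN2 UL.
have LN1 : infsub L N1.
  exact: infsub_trans LN2 (infsub_trans (infsub_above _ N2N1.2) N2N1).
have LN : infsub L N by apply: infsub_trans (infsub_trans N1N0 N0N).
have [n nU] := oU L LN UL.
pose init k := [seq x <- iota 0 k | `[< L x >]].
(* All initial segments of [L] are rejected. The element [m] of [N2] separates the current segment
   from the rest of [L], which is what the heredity of [N2] asks for. *)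
have [rn _] : rejects N1 (init n) /\ exists m, [/\ N2 m,
    init n \in sublists (iota 0 m.+1) & forall y, L y -> (n <= y)%N -> (m < y)%N].
  elim: n {nU} => [|k [rk [m [Nm km mL]]]].
    split; first exact: rejects_sub rN0.
    exists (minelt N2); split=> //; last by move=> y /LN2.1[].
    by rewrite mem_sublists sub0seq.
  have kE : init k.+1 = if `[< L k >] then rcons (init k) k else init k.
    by rewrite /init -addn1 iotaD filter_cat /= add0n -cats1; case: ifP; rewrite ?cats0.
  rewrite kE; case: ifPn => [/asboolP Lk|/asboolP nLk]; last first.
    split=> //; exists m; split=> // y Ly ky; apply: mL => //; exact: ltnW.
  have mk := mL k Lk (leqnn k); have [N2k _] := LN2.1 _ Lk; split.
    by apply: (rN2 m Nm m (leqnn m)) => //; split.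
  exists k; split=> //.
  rewrite mem_sublists -cats1 -addn1 iotaD cat_subseq//.
  exact: filter_subseq.
(* By openness, every set that agrees with [L] below [n] lies in [U]; so [init n] is accepted by the
   part of [N1] from [n] on, a contradiction. *)
apply: (rn (above N1 n)); first exact: infsub_above.
move=> L' L'N1 nL'; apply: nU.
  split.
    move=> x [|/L'N1.1[/N1N0.1/N0N.1//]].
    by rewrite mem_filter => /andP[/asboolP/LN.1].
  by apply: (@unbounded_sub L'); [move=> x; right|case: L'N1].
move=> x xn; split=> [Lx|[|/L'N1.1[_]]].
- by left; rewrite mem_filter mem_iota /= add0n xn andbT; apply/asboolP.
- by rewrite mem_filter => /andP[/asboolP].
- by rewrite leqNgt xn.
Qed.
End Ramsey.

(** * Countable ordinals *)

Lemma omega1_ind (P : omega1 -> Prop) :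
  (forall a, (forall b, (b < a)%O -> P b) -> P a) -> forall a, P a.
Proof. exact: (well_founded_ind omega1_wf). Qed.

Lemma omega1_cases a :
  [\/ is_zero a, exists b, a = osucc b | is_limit a].
Proof.
have [a0|a0] := pselect (is_zero a); first exact: Or31.
have [[b ba]|nb] := pselect (exists b, is_succ b a).
  apply: Or32; exists b; have [ltb minb] := osuccP b; have [lta mina] := ba.
  by apply/eqP; rewrite eq_le mina// minb.
by apply: Or33; split=> // b ba; apply: nb; exists b.
Qed.

Lemma lt_osucc b : (b < osucc b)%O. Proof. by case: (osuccP b). Qed.

Lemma le_osucc b : (b <= osucc b)%O. Proof. exact/ltW/lt_osucc. Qed.

Lemma lt_osucc_le a b : (a < osucc b)%O = (a <= b)%O.
Proof.
apply/idP/idP => [ab|/le_lt_trans]; last by apply; exact: lt_osucc.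
by rewrite leNgt; apply/negP => /(osuccP b).2; rewrite leNgt ab.
Qed.

(** Otherwise [omega1] would be a countable union of countable initial segments. *)
Lemma omega1_sup (u : nat -> omega1) : exists a, forall n, (u n <= a)%O.
Proof.
apply: contrapT => /forallNP nu; apply: omega1_uncountable.
apply: (@sub_countable _ _ _ (\bigcup_n [set y | (y <= u n)%O])).
  apply: subset_card_le => a _; have /existsNP[n /negP] := nu a.
  by rewrite -ltNge => /ltW; exists n.
by apply: bigcup_countable => // n _; exact: omega1_countable_below.
Qed.

Lemma omega1_sup_countable (T : countType) (u : T -> omega1) (a0 : omega1) :
  exists2 a, (a0 <= a)%O & forall x, (u x <= a)%O.
Proof.
have [a aP] := omega1_sup (fun n => Order.max a0 (oapp u a0 (unpickle n))).
exists a; first by have := aP 0%N; rewrite ge_max => /andP[].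
by move=> x; have := aP (pickle x); rewrite pickleK ge_max => /andP[].
Qed.

Lemma limit_cofinal s a b : associated_sequences s -> is_limit a -> (b < a)%O ->
  exists n0, forall n, (n0 <= n)%N -> (b <= s a n)%O.
Proof.
move=> [_ sl] /sl[s_lt _ s_cof] /s_cof[n0]; rewrite lt_osucc_le => bn0.
exists n0 => n; rewrite leq_eqVlt => /predU1P[<-//|/s_lt].
by rewrite lt_osucc_le; apply: le_trans; exact: le_trans bn0 (le_osucc _).
Qed.

Lemma limit_lt s a n : associated_sequences s -> is_limit a -> (s a n < a)%O.
Proof.
by move=> [_ sl] /sl[_ sa _]; exact: lt_trans (lt_osucc _) (sa n).
Qed.

(** * Real and imaginary parts of scalars *)

Section Scalars.
Context {R : realType} {k : scalar_kind}.
Local Notation S := (scalars R k).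

Definition re : S -> R :=
  match k return scalars R k -> R with
  | RealScalars => id
  | ComplexScalars => fun z => complex.Re z
  end.

Definition im : S -> R :=
  match k return scalars R k -> R with
  | RealScalars => fun=> 0
  | ComplexScalars => fun z => complex.Im z
  end.

Definition emb : R -> S :=
  match k return R -> scalars R k with
  | RealScalars => id
  | ComplexScalars => fun r => r%:C%C
  end.

(** The modulus as a real number: complex scalars are only partially ordered, so all estimates are
    made in [R]. *)
Definition av (z : S) : R := re `|z|.

Lemma re0 : re 0 = 0. Proof. by rewrite /re; case: k. Qed.
Lemma im0 : im 0 = 0. Proof. by rewrite /im; case: k. Qed.

Lemma reD x y : re (x + y) = re x + re y.
Proof. by move: x y; rewrite /re; case: k => //= -[a b] [c d]. Qed.

Lemma imD x y : im (x + y) = im x + im y.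
Proof.
by move: x y; rewrite /im; case: k => /= [x y|[a b] [c d]//]; rewrite addr0.
Qed.

Lemma re_ge0 x : 0 <= x -> 0 <= re x.
Proof. by move: x; rewrite /re; case: k => //= -[a b]; rewrite lecE/= => /andP[]. Qed.

Lemma re_le x y : x <= y -> re x <= re y.
Proof.
move: x y; rewrite /re; case: k => //= -[a b] [c d].
by rewrite lecE/= => /andP[].
Qed.

Lemma re_gt0 x : 0 < x -> 0 < re x.
Proof. by move: x; rewrite /re; case: k => //= -[a b]; rewrite ltcE/= => /andP[]. Qed.

Lemma emb_re x : 0 <= x -> emb (re x) = x.
Proof.
move: x; rewrite /re /emb; case: k => //= -[a b].
by rewrite lecE/= => /andP[/eqP ->].
Qed.

Lemma re_emb r : re (emb r) = r.
Proof. by move: r; rewrite /re /emb; case: k. Qed.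

Lemma emb_le x y : (emb x <= emb y) = (x <= y).
Proof. by rewrite /emb; case: k => //=; rewrite lecR. Qed.

Lemma emb_lt x y : (emb x < emb y) = (x < y).
Proof. by rewrite /emb; case: k => //=; rewrite ltcR. Qed.

Lemma emb0 : emb 0 = 0. Proof. by rewrite /emb; case: k. Qed.

Lemma re_leE x y : 0 <= x -> 0 <= y -> (re x <= re y) = (x <= y).
Proof. by move=> x0 y0; rewrite -emb_le !emb_re. Qed.

Lemma reM c z : 0 <= c -> re (c * z) = re c * re z.
Proof.
move: c z; rewrite /re; case: k => //= -[a b] [c d]; rewrite lecE/= => /andP[/eqP-> _].
by rewrite mul0r subr0.
Qed.

Lemma imM c z : 0 <= c -> im (c * z) = re c * im z.
Proof.
move: c z; rewrite /re /im; case: k => /= [c z _|]; first by rewrite mulr0.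
by move=> -[a b] [c d]; rewrite lecE/= => /andP[/eqP-> _]; rewrite mul0r addr0.
Qed.

Lemma re1 : re 1 = 1. Proof. by rewrite /re; case: k. Qed.

Lemma re_natr n : re n%:R = n%:R.
Proof. by elim: n => [|n IH]; rewrite ?re0// -!natr1 reD IH re1. Qed.

Lemma av_ge0 z : 0 <= av z. Proof. exact: re_ge0. Qed.
Lemma av0 : av 0 = 0. Proof. by rewrite /av normr0 re0. Qed.
Lemma av1 : av 1 = 1. Proof. by rewrite /av normr1 re1. Qed.
Lemma avD x y : av (x + y) <= av x + av y.
Proof. by rewrite /av -reD re_le// ler_normD. Qed.
Lemma avN x : av (- x) = av x. Proof. by rewrite /av normrN. Qed.
Lemma avM x y : av (x * y) = av x * av y.
Proof. by rewrite /av normrM reM. Qed.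
Lemma av_ge0E c : 0 <= c -> av c = re c.
Proof. by move=> c0; rewrite /av ger0_norm. Qed.
Lemma av_eq0 x : av x = 0 -> x = 0.
Proof.
rewrite /av => x0; apply/eqP; rewrite -normr_eq0 -(emb_re (normr_ge0 x)) x0.
by rewrite emb0.
Qed.
Lemma avV x : av x^-1 = (av x)^-1.
Proof.
have [->|x0] := eqVneq x 0; first by rewrite invr0 av0 invr0.
have ax : av x != 0 by apply: contra_neq x0; exact: av_eq0.
by apply: (mulfI ax); rewrite -avM !mulfV// av1.
Qed.
Lemma av_natr n : av n%:R = n%:R.
Proof. by rewrite av_ge0E// re_natr. Qed.

Lemma av_sum (I : Type) (r : seq I) (P : pred I) (F : I -> S) :
  av (\sum_(i <- r | P i) F i) <= \sum_(i <- r | P i) av (F i).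
Proof.
elim/big_ind2 : _ => [|x1 x2 y1 y2 h1 h2|//]; first by rewrite av0.
by apply: (le_trans (avD _ _)); exact: lerD.
Qed.

(** The four functions Re, -Re, Im and -Im: the first component of [b] is the sign, the second
    selects the imaginary part. *)
Definition part (b : bool * bool) (z : S) : R :=
  (-1) ^+ b.1 * (if b.2 then im z else re z).

Lemma part0 b : part b 0 = 0.
Proof. by rewrite /part re0 im0; case: b.2; rewrite mulr0. Qed.

Lemma partD b x y : part b (x + y) = part b x + part b y.
Proof. by rewrite /part; case: b.2; rewrite ?reD ?imD mulrDr. Qed.

Lemma partM b c z : 0 <= c -> part b (c * z) = re c * part b z.
Proof. by move=> c0; rewrite /part; case: b.2; rewrite ?reM ?imM// mulrCA. Qed.

Lemma normr_re_le z : `|re z| <= av z.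
Proof.
move: z; rewrite /av /re; case: k => //= -[a b] /=.
by rewrite -sqrtr_sqr ler_wsqrtr// lerDl sqr_ge0.
Qed.

Lemma normr_im_le z : `|im z| <= av z.
Proof.
move: z; rewrite /av /re /im; case: k => /= [z|[a b]] /=; first by rewrite normr0.
by rewrite -sqrtr_sqr ler_wsqrtr// lerDr sqr_ge0.
Qed.

Lemma part_le b z : part b z <= av z.
Proof.
apply: (le_trans (ler_norm _)); rewrite /part normrM normrX normrN1 expr1n mul1r.
by case: b.2; [exact: normr_im_le|exact: normr_re_le].
Qed.

Lemma partN b z : part b (- z) = - part b z.
Proof. by apply/eqP; rewrite -addr_eq0 -partD addNr part0. Qed.

Lemma part_ge b z : - av z <= part b z.
Proof. by rewrite lerNl -partN -(avN z) part_le. Qed.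

Lemma av_le_parts z : av z <= \sum_(b : bool * bool) Num.max 0 (part b z).
Proof.
have max2 (x : R) : Num.max 0 x + Num.max 0 (- x) = `|x|.
  by case: (lerP 0 x) => x0; case: (lerP 0 (- x)) => nx;
    [rewrite ger0_norm|rewrite ger0_norm|rewrite ltr0_norm|rewrite ltr0_norm] => //; lra.
suff zE : av z <= `|re z| + `|im z|.
  apply: (le_trans zE); rewrite le_eqVlt; apply/orP; left; apply/eqP.
  rewrite -(pair_bigA _ (fun b1 b2 => Num.max 0 (part (b1, b2) z)))/=.
  rewrite !big_bool /part /= !expr1 !expr0 !mulN1r !mul1r -!max2; ring.
move: z; rewrite /av /re /im; case: k => /= [z|[a b]] /=; first by rewrite normr0 addr0.
rewrite -[leRHS]ger0_norm ?addr_ge0// -sqrtr_sqr ler_wsqrtr//.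
rewrite sqrrD !real_normK ?num_real//.
by rewrite -addrA lerD2l lerDr mulrn_wge0// mulr_ge0.
Qed.

End Scalars.

(** * Combinations of continuous functions *)

Section Evaluation.
Context {R : realType} {k : scalar_kind} {K : metricType R}.
Context {cK : compact [set: K]}.
Local Notation S := (scalars R k).
Variable f : nat -> CK k cK.

Definition ev (p : {poly S}) (t : K) : S := lincomb f p t.

Definition nrm (p : {poly S}) : R := re `|lincomb f p|.

Lemma lincomb_wide n (p : {poly S}) : (size p <= n)%N ->
  lincomb f p = \sum_(i < n) p`_i *: f i.
Proof.
move=> pn; rewrite /lincomb (big_ord_widen _ (fun i => p`_i *: f i) pn) big_mkcond /=.
by apply: eq_bigr => i _; case: ltnP => // pi; rewrite nth_default ?scale0r.
Qed.

Lemma lincombD p q : lincomb f (p + q) = lincomb f p + lincomb f q.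
Proof.
pose n := maxn (size p) (size q).
rewrite !(@lincomb_wide n) ?leq_maxl ?leq_maxr ?size_polyD//.
by rewrite -big_split; apply: eq_bigr => i _; rewrite coefD scalerDl.
Qed.

Lemma lincombZ c p : lincomb f (c *: p) = c *: lincomb f p.
Proof.
rewrite (@lincomb_wide (size p)) ?size_scale_leq// /lincomb scaler_sumr.
by apply: eq_bigr => i _; rewrite coefZ scalerA.
Qed.

Lemma lincomb0 : lincomb f 0 = 0.
Proof. by rewrite /lincomb size_poly0 big_ord0. Qed.

Lemma lincombX n : lincomb f 'X^n = f n.
Proof.
rewrite (@lincomb_wide n.+1) ?size_polyXn// (bigD1 ord_max)//= coefXn eqxx scale1r.
rewrite big1 ?addr0// => i /eqP ni; rewrite coefXn; case: eqVneq; rewrite ?scale0r//.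
by move=> eni; case: ni; apply/val_inj.
Qed.

Lemma evD p q t : ev (p + q) t = ev p t + ev q t.
Proof. by rewrite /ev lincombD. Qed.

Lemma evZ c p t : ev (c *: p) t = c * ev p t.
Proof. by rewrite /ev lincombZ. Qed.

Lemma ev0 t : ev 0 t = 0. Proof. by rewrite /ev lincomb0. Qed.

Lemma evX n t : ev 'X^n t = f n t. Proof. by rewrite /ev lincombX. Qed.

Lemma ev_sum (I : Type) (r : seq I) (P : pred I) (F : I -> {poly S}) t :
  ev (\sum_(i <- r | P i) F i) t = \sum_(i <- r | P i) ev (F i) t.
Proof.
elim/big_ind2 : _ => [|p x q y <- <-|//]; first exact: ev0.
exact: evD.
Qed.

Lemma evE n (p : {poly S}) t : (size p <= n)%N -> ev p t = \sum_(i < n) p`_i * f i t.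
Proof.
move=> pn; rewrite /ev (lincomb_wide pn).
by apply: (big_morph (fun g : CK k cK => CK_fun g t)) => // x y; exact: CK_addE.
Qed.

Lemma nrm_ge0 p : 0 <= nrm p. Proof. exact: re_ge0. Qed.

Lemma nrm_ub p t : av (ev p t) <= nrm p.
Proof. by rewrite /av /nrm re_le// /ev CK_normE CK_norm_ub. Qed.

Lemma nrm_le p (B : R) : 0 <= B -> (forall t, av (ev p t) <= B) -> nrm p <= B.
Proof.
move=> B0 pB; rewrite -(@re_emb R k B) /nrm re_le// CK_normE CK_norm_le//.
  by rewrite -(@emb0 R k) emb_le.
by move=> t; rewrite -(emb_re (normr_ge0 _)) emb_le; exact: pB.
Qed.

Lemma nrmD p q : nrm (p + q) <= nrm p + nrm q.
Proof. by rewrite /nrm -reD re_le// lincombD ler_normD. Qed.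

Lemma nrmZ c p : nrm (c *: p) = av c * nrm p.
Proof. by rewrite /nrm lincombZ normrZ reM. Qed.

Lemma nrm0 : nrm 0 = 0. Proof. by rewrite /nrm lincomb0 normr0 re0. Qed.

Lemma nrmN p : nrm (- p) = nrm p.
Proof. by rewrite -scaleN1r nrmZ avN av1 mul1r. Qed.

Lemma unitizeE p : unitize f p = (emb (nrm p))^-1 *: p.
Proof. by rewrite /unitize /nrm emb_re. Qed.

Lemma emb_inv_ge0 x : 0 <= x -> 0 <= (emb x : S)^-1.
Proof. by move=> x0; rewrite invr_ge0 -(@emb0 R k) emb_le. Qed.

Lemma re_emb_inv x : 0 <= x -> re ((emb x : S)^-1) = x^-1.
Proof.
move=> x0; rewrite -av_ge0E ?emb_inv_ge0// avV av_ge0E ?re_emb//.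
by rewrite -(@emb0 R k) emb_le.
Qed.

Lemma nrm_unitize p : nrm p != 0 -> nrm (unitize f p) = 1.
Proof.
move=> p0; rewrite unitizeE nrmZ av_ge0E ?emb_inv_ge0 ?nrm_ge0//.
by rewrite re_emb_inv ?nrm_ge0// mulVf.
Qed.

Lemma av_ev_unitize p t : av (ev (unitize f p) t) = av (ev p t) / nrm p.
Proof.
rewrite unitizeE evZ avM av_ge0E ?emb_inv_ge0 ?nrm_ge0//.
by rewrite re_emb_inv ?nrm_ge0// mulrC.
Qed.

Lemma part_ev_unitize b p t :
  part b (ev (unitize f p) t) = part b (ev p t) / nrm p.
Proof.
rewrite unitizeE evZ partM ?emb_inv_ge0 ?nrm_ge0//.
by rewrite re_emb_inv ?nrm_ge0// mulrC.
Qed.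

Lemma finite_net n (d : R) : 0 < d -> exists A : seq K, forall t,
  exists2 a, a \in A & forall i, (i < n)%N -> av (f i t - f i a) <= d.
Proof.
move=> d0; have ed : 0 < (emb d : S) by rewrite -(@emb0 R k) emb_lt.
pose U (t : K) := [set s : K | forall i, (i < n)%N -> `|f i s - f i t| < (emb d : S)].
have Ut t : nbhs t (U t).
  rewrite /U; elim: n {U} => [|n IH]; first by near=> s.
  have cf : \forall s \near t, `|f n s - f n t| < (emb d : S).
    have := @CK_continuous _ _ _ _ (f n) t => /cvgrPdist_lt/(_ _ ed).
    by apply: filterS => s; rewrite distrC.
  near=> s => i; rewrite ltnS leq_eqVlt => /predU1P[->|].
    by near: s.
  by move: i; near: s; exact: IH.
(* Finite lists of points directed by inclusion: compactness along this filter turns the local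
   approximations into a single finite net. *)
pose F : set_system (seq K) := filter_from setT
  (fun l0 : seq K => [set l : seq K | {subset l0 <= l}]).
have FF : Filter F.
  apply: filter_from_filter; first by exists [::].
  move=> l1 l2 _ _; exists (l1 ++ l2) => // l ll /=.
  by split=> x xl; apply: ll; rewrite mem_cat xl ?orbT.
have [|l0 _ l0P] := (compact_near_coveringP [set: K]).1 cK _ F
    (fun l t => exists2 a, a \in l & U a t) FF.
  move=> t _; exists (U t, [set l : seq K | {subset [:: t] <= l}]).
    by split; [exact: Ut|exists [:: t]].
  by move=> [s l] [/= Us tl]; exists t => //; apply: tl; rewrite mem_head.
exists l0 => t; have [a al aU] := l0P l0 (fun=> id) t I.
exists a => // i /aU lt_d; rewrite -(@re_emb R k d) /av re_le//; exact: ltW.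
Unshelve. all: by end_near.
Qed.

End Evaluation.

(** * Tails of the summable sequence *)

Section Tail.
Context {R : realType} {k : scalar_kind}.
Variable eps : nat -> scalars R k.
Hypothesis eps_gt0 : forall n, 0 < eps n.
Hypothesis eps_summable : cvgn (series eps).

(** [tail n] is the sum of the real numbers [re (eps i)] over $i\ge n$, obtained as the supremum of
    the partial sums minus the n-th of them. *)
Lemma summable_tail : exists tail : nat -> R,
  [/\ forall n, 0 <= tail n, forall n, tail n = re (eps n) + tail n.+1 &
      forall d, 0 < d -> exists n0, forall n, (n0 <= n)%N -> tail n <= d].
Proof.
pose E n := \sum_(i < n) re (eps i).
have ES n : E n.+1 = E n + re (eps n) by rewrite /E big_ord_recr.
have E_le m n : (m <= n)%N -> E m <= E n.
  move=> /subnK <-; elim: (n - m)%N => // i IH; rewrite addSn ES.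
  by rewrite (le_trans IH)// lerDl ltW// re_gt0.
have reE n : re (series eps n) = E n.
  rewrite /series /= big_mkord; elim: n => [|n IH]; first by rewrite /E !big_ord0 re0.
  by rewrite big_ord_recr /= reD IH ES.
have [B EB] : exists B, forall n, E n <= B.
  have [l /cvgrPdist_lt/(_ 1 ltr01)[n0 _ n0P]] := (cvg_ex _).1 eps_summable.
  exists (av l + 1) => n; apply: (le_trans (E_le _ _ (leq_addl n0 n))).
  have /ltW/re_le := n0P (n0 + n)%N (leq_addr _ _); rewrite re1 => lt1.
  rewrite -reE -{1}[series eps _](subrK l) reD addrC lerD//.
    by apply: le_trans (ler_norm _) (normr_re_le _).
  apply: le_trans (ler_norm _) (le_trans (normr_re_le _) _).
  by rewrite /av distrC.
have supE : has_sup (range E).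
  by split; [exists (E 0%N), 0%N|exists B => _ [n _ <-]].
exists (fun n => sup (range E) - E n); split.
- by move=> n; rewrite subr_ge0; apply: sup_upper_bound => //; exists n.
- by move=> n; rewrite ES; ring.
- move=> d d0; have [_ [n0 _ <-] n0P] := sup_adherent d0 supE.
  by exists n0 => n /E_le n0n; rewrite lerBlDr -lerBlDl ltW// (lt_le_trans n0P).
Qed.

End Tail.

Lemma natSinv_le (R : realType) (d : R) : 0 < d ->
  exists n0, forall n, (n0 <= n)%N -> n.+1%:R^-1 <= d.
Proof.
move=> d0; have [n0 _ n0P] := near_infty_natSinv_lt (PosNum d0).
by exists n0 => n /n0P/ltW.
Qed.

(** * Selection of a sparse set of indices with good initial projections *)

Section Selection.
Context {R : realType} {k : scalar_kind} {K : metricType R}.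
Context {cK : compact [set: K]}.
Local Notation S := (scalars R k).
Variable f : nat -> CK k cK.
Hypothesis f_norm : normalized_seq f.

Lemma nrmX n : nrm f 'X^n = 1.
Proof. by rewrite /nrm lincombX f_norm re1. Qed.

Lemma take_polyS j (p : {poly S}) :
  take_poly j.+1 p = take_poly j p + p`_j *: 'X^j.
Proof.
apply/polyP => i; rewrite coefD coefZ coefXn !coef_take_poly ltnS leq_eqVlt.
case: eqVneq => [->|_] /=; first by rewrite ltnn add0r mulr1.
by rewrite mulr0 addr0.
Qed.

Lemma coef_le_nrm j (p : {poly S}) :
  av p`_j <= nrm f (take_poly j.+1 p) + nrm f (take_poly j p).
Proof.
have := nrmD f (take_poly j.+1 p) (- take_poly j p); rewrite nrmN.
by rewrite take_polyS addrAC subrr add0r nrmZ nrmX mulr1.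
Qed.

Variables (eps : nat -> S) (tail : nat -> R) (M : set nat).
Hypothesis eps_gt0 : forall n, 0 < eps n.
Hypothesis tail_ge0 : forall n, 0 <= tail n.
Hypothesis tailE : forall n, tail n = re (eps n) + tail n.+1.
Hypothesis tail_to0 :
  forall d : R, 0 < d -> exists n0, forall n, (n0 <= n)%N -> tail n <= d.
Hypothesis M_unbounded : unbounded M.
Hypothesis f_small :
  forall t : K, finite_set [set n | M n /\ eps n <= `|f n t|].

Lemma ev_eps_le m n (p : {poly S}) t B : 0 <= B -> (m <= n)%N ->
  (forall i, av p`_i <= B) ->
  (forall i, p`_i != 0 -> [/\ (m <= i)%N, (i < n)%N & av (f i t) <= re (eps i)]) ->
  av (ev f p t) <= B * (tail m - tail n).
Proof.
move=> B0 mn pB pi.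
have pn : (size p <= n)%N.
  apply/leq_sizeP => j nj; apply/eqP; apply: contraTT nj => /pi[_ jn _].
  by rewrite -ltnNge.
rewrite (evE f t pn) -(subnKC mn) big_split_ord /= big1 ?add0r; last first.
  move=> i _; have [->|/pi[]] := eqVneq p`_(lshift (n - m) i) 0; first by rewrite mul0r.
  by rewrite /= leqNgt ltn_ord.
apply: (le_trans (av_sum _ _ _)).
apply: (@le_trans _ _ (\sum_(i < n - m) B * re (eps (m + i)%N))).
  apply: ler_sum => i _ /=; rewrite avM.
  have [->|/pi[_ _ fi]] := eqVneq p`_(m + i) 0.
    by rewrite av0 mul0r mulr_ge0// ltW// re_gt0.
  by apply: ler_pM => //; exact: av_ge0.
rewrite -mulr_sumr ler_wpM2l//; elim: (n - m)%N => [|d IH].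
  by rewrite big_ord0 addn0 subrr.
rewrite big_ord_recr /= addnS; have := tailE (m + d)%N; lra.
Qed.

(** For [n] in [N0], the functions with later indices in [N0] are below their [eps] on a finite net
    that controls $f_0,\dots,f_n$. The initial part of a combination [p] up to [n] thus nearly keeps
    its value when a point is replaced by a net point, and there the rest of [p] is negligible. *)
Lemma basic_selection : exists N0, [/\ infsub N0 M,
  forall p : {poly S}, supp p `<=` N0 -> forall i, av p`_i <= 4 * nrm f p,
  forall p : {poly S}, supp p `<=` N0 -> forall j,
    nrm f (take_poly j p) <= 2 * nrm f p &
  forall d : R, 0 < d -> exists n0, forall p : {poly S}, supp p `<=` N0 ->
    (forall i, (i < n0)%N -> p`_i = 0) -> forall j,
    nrm f (take_poly j p) <= (1 + d) * nrm f p].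
Proof.
pose dl n : R := n.+1%:R^-1.
have dl_gt0 n : 0 < dl n by rewrite invr_gt0.
have dl_to0 (d : R) : 0 < d -> exists n0, forall n, (n0 <= n)%N -> dl n <= d.
  exact: natSinv_le.
(* The mesh is $1/(n+1)^2$: with coefficients at most [B], the [n.+1] terms together vary by at most
   [B * dl n]. *)
have /choice[A AP] n : exists A : seq K, forall t, exists2 a, a \in A &
    forall i, (i < n.+1)%N -> av (f i t - f i a) <= dl n / n.+1%:R.
  by apply: finite_net; rewrite divr_gt0.
have /choice[h hP] n : exists h, forall a, a \in A n ->
    forall m, M m -> (h <= m)%N -> av (f m a) <= re (eps m).
  elim: (A n) => [|a l [h hl]]; first by exists 0%N.
  have /finite_seqP[s sE] := f_small a.
  exists (maxn h (\max_(i <- s) i).+1) => b; rewrite inE => /predU1P[->|bl] m Mm.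
    rewrite geq_max => /andP[_ sm]; rewrite leNgt; apply/negP => lt_e.
    have : [set` s] m.
      by rewrite -sE; split=> //; rewrite -re_leE ?(ltW lt_e)// ltW// eps_gt0.
    by move=> ms; have := @leq_bigmax_seq _ s xpredT id m ms isT; rewrite leqNgt sm.
  by rewrite geq_max => /andP[hm _]; exact: hl.
(* The errors [dl n] and [tail n.+1] then add up to at most 1/12, so the largest coefficient [B] of
   [p] satisfies $B\le 2\|p\|+B/6$, whence $B\le 4\|p\|$. *)
have c24 : 0 < 24%:R^-1 :> R by rewrite invr_gt0.
have [n1 n1P] := dl_to0 _ c24; have [n2 n2P] := tail_to0 c24.
pose M' := above M (maxn n1 n2).
have uM' : unbounded M' by exact: unbounded_above.
have [||N0 N0M' N0P] := @diagonal_dense (fun n L => forall x, L x -> (h n <= x)%N) M' uM'.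
- by move=> n L L' [L'L _] hL x /L'L; exact: hL.
- by move=> n L [_ uL]; exists (above L (h n)); [exact: infsub_above|move=> x []].
have N0M : infsub N0 M by apply: infsub_trans N0M' (infsub_above _ M_unbounded).
(* The point [t] is moved to the net point [a]: [e1] bounds the change of the initial part [e], and
   [e2] bounds the rest [p - e] at [a]. *)
have key (p : {poly S}) n (B : R) : supp p `<=` N0 -> 0 <= B -> (forall i, av p`_i <= B) ->
    N0 n -> nrm f (take_poly n.+1 p) <= nrm f p + B * (dl n + tail n.+1).
  move=> pN0 B0 pB N0n; apply: nrm_le => [|t].
    by rewrite addr_ge0 ?nrm_ge0// mulr_ge0// addr_ge0// ltW.
  have [a aA fa] := AP n t; pose e := take_poly n.+1 p.
  have se : (size e <= n.+1)%N by exact: size_take_poly.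
  have -> : ev f e t = ev f e a + (ev f e t - ev f e a) by rewrite addrC subrK.
  have e1 : av (ev f e t - ev f e a) <= B * dl n.
    rewrite !(evE f _ se) -sumrB; apply: (le_trans (av_sum _ _ _)).
    apply: (@le_trans _ _ (\sum_(i < n.+1) B * (dl n / n.+1%:R))).
      apply: ler_sum => i _; rewrite -mulrBr avM ler_pM ?av_ge0//.
        by rewrite coef_take_poly ltn_ord.
      exact: fa.
    by rewrite sumr_const card_ord -[leLHS]mulr_natr -!mulrA mulVf// mulr1.
  have e2 : av (ev f (p - e) a) <= B * tail n.+1.
    apply: (@le_trans _ _ (B * (tail n.+1 - tail (maxn n.+1 (size p))))).
      apply: ev_eps_le => //; first exact: leq_maxl.
        move=> i; rewrite coefB coef_take_poly; case: ifP => _; last by rewrite subr0.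
        by rewrite subrr av0 (le_trans (av_ge0 p`_i)).
      move=> i; rewrite coefB coef_take_poly; case: ltnP => [_|ni].
        by rewrite subrr eqxx.
      rewrite subr0 => pi; split=> //.
        rewrite leq_max orbC ltnNge; apply/orP; left; apply: contra pi => /leq_sizeP pi.
        by rewrite pi.
      have N0i := pN0 _ pi; apply: (hP n) => //; first exact: N0M.1.
      by apply: (N0P n N0n n (leqnn n)); split.
    by rewrite ler_wpM2l// lerBlDr lerDl.
  have e3 : av (ev f e a) <= nrm f p + B * tail n.+1.
    have -> : ev f e a = ev f p a + - ev f (p - e) a.
      by apply/eqP; rewrite eq_sym subr_eq -evD addrC subrK.
    by apply: (le_trans (avD _ _)); rewrite avN lerD// nrm_ub.
  have := avD (ev f e a) (ev f e t - ev f e a); rewrite mulrDr; lra.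
have key2 (p : {poly S}) (g B : R) : supp p `<=` N0 -> 0 <= g -> 0 <= B ->
    (forall i, av p`_i <= B) -> (forall n, supp p n -> dl n + tail n.+1 <= g) ->
    forall j, nrm f (take_poly j p) <= nrm f p + B * g.
  move=> pN0 g0 B0 pB pg; elim=> [|j IH].
    by rewrite take_poly0l nrm0 addr_ge0 ?nrm_ge0// mulr_ge0.
  have [pj|pj] := eqVneq p`_j 0; first by rewrite take_polyS pj scale0r addr0.
  apply: (le_trans (key _ _ _ pN0 B0 pB (pN0 _ pj))).
  by rewrite lerD2l ler_wpM2l// pg.
have B1 (p : {poly S}) : supp p `<=` N0 -> forall i, av p`_i <= 4 * nrm f p.
  move=> pN0; pose B := \big[Num.max/0]_(i < size p) av p`_i.
  have pB i : av p`_i <= B.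
    have [si|si] := ltnP i (size p); first exact: (le_bigmax _ (fun i : 'I__ => av p`_i) (Ordinal si)).
    by rewrite nth_default// av0 bigmax_ge_id.
  have B0 : 0 <= B by rewrite bigmax_ge_id.
  have p12 n : supp p n -> dl n + tail n.+1 <= 12%:R^-1.
    move=> /pN0/N0M'.1[_]; rewrite geq_max => /andP[/n1P dn n2n].
    have tn := n2P n.+1 (leqW n2n); lra.
  have tk j : nrm f (take_poly j p) <= nrm f p + B * 12%:R^-1.
    by apply: key2 => //; rewrite invr_ge0.
  have BB : B <= 2 * nrm f p + B / 6%:R.
    apply/bigmax_leP; split.
      by rewrite addr_ge0 ?mulr_ge0 ?nrm_ge0// invr_ge0.
    move=> i _; apply: (le_trans (coef_le_nrm _ _)).
    have := tk i; have := tk i.+1; lra.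
  move=> i; apply: (le_trans (pB i)); have := nrm_ge0 f p; lra.
exists N0; split=> //.
  move=> p pN0 j; have p12 n : supp p n -> dl n + tail n.+1 <= 12%:R^-1.
    move=> /pN0/N0M'.1[_]; rewrite geq_max => /andP[/n1P dn n2n].
    have tn := n2P n.+1 (leqW n2n); lra.
  have p0 := nrm_ge0 f p.
  have := @key2 p 12%:R^-1 (4 * nrm f p) pN0 _ _ (B1 p pN0) p12 j.
  rewrite invr_ge0 ler0n mulr_ge0// => /(_ isT isT); lra.
move=> d d0; have d8 : 0 < d / 8%:R by rewrite divr_gt0.
have [n3 n3P] := dl_to0 _ d8; have [n4 n4P] := tail_to0 d8.
exists (maxn n3 n4) => p pN0 plow j; have p0 := nrm_ge0 f p.
have pd n : supp p n -> dl n + tail n.+1 <= d / 4%:R.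
  move=> pn; have : (maxn n3 n4 <= n)%N.
    by rewrite leqNgt; apply/negP => /plow pn0; move: pn; rewrite /supp /= pn0 eqxx.
  rewrite geq_max => /andP[/n3P dn n4n]; have tn := n4P n.+1 (leqW n4n); lra.
have d4 : 0 <= d / 4%:R by rewrite divr_ge0// ltW.
have p4 : 0 <= 4 * nrm f p by rewrite mulr_ge0.
have := @key2 p (d / 4%:R) (4 * nrm f p) pN0 d4 p4 (B1 p pN0) pd j.
by rewrite [X in _ + X](_ : _ = d * nrm f p); [rewrite mulrDl mul1r|field].
Qed.

End Selection.

(** * Structure of the transfinite averages *)

Section Covers.
Context {S : numFieldType}.
Implicit Types (p q : {poly S}) (L : set nat).

(** The support is an initial segment of [L]. Nonnegative coefficients exclude cancellation, so that
    the property passes to sums of consecutive blocks. *)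
Definition covers L p := [/\ forall i, 0 <= p`_i, supp p `<=` L &
  forall x, L x -> (x < size p)%N -> p`_x != 0].

Lemma beyondE L p : beyond L p = above L (size p).
Proof.
apply/seteqP; split=> x [Lx px]; split=> //.
  rewrite leqNgt; apply/negP => xp.
  have p0 : p != 0 by apply: contraTneq xp => ->; rewrite size_poly0.
  have := px (size p).-1; rewrite /supp /= -lead_coefE lead_coef_eq0 p0 => /(_ isT).
  by move: xp; case: (size p) => // n; rewrite ltnS => /leq_ltn_trans/[apply]; rewrite ltnn.
move=> i pi; apply: leq_trans px; rewrite ltnNge; apply: contra pi => pi.
by rewrite nth_default.
Qed.

Lemma supp_ltn p i : supp p i -> (i < size p)%N.
Proof.
by move=> pi; rewrite ltnNge; apply: contra pi => pi; rewrite nth_default.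
Qed.

Lemma size_nonneg_addl p q : (forall i, 0 <= p`_i) -> (forall i, 0 <= q`_i) ->
  (size p <= size (p + q)%R)%N.
Proof.
move=> p0 q0; have [->|np] := eqVneq p 0; first by rewrite size_poly0.
rewrite leqNgt; apply/negP => pq.
have : lead_coef p + q`_(size p).-1 = 0.
  rewrite lead_coefE -coefD nth_default//.
  by move: pq; case: (size p).
move/eqP; rewrite lead_coefE paddr_eq0// -lead_coefE lead_coef_eq0.
by rewrite (negbTE np).
Qed.

Lemma covers_add L p q : covers L p -> covers (above L (size p)) q ->
  covers L (p + q).
Proof.
move=> [p0 pL pg] [q0 qL qg]; split.
- by move=> i; rewrite coefD addr_ge0.
- move=> x; rewrite /supp /= coefD paddr_eq0// negb_and => /orP[/pL//|/qL[]//].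
- move=> x Lx xs; rewrite coefD paddr_eq0// negb_and.
  have [xp|px] := ltnP x (size p); first by rewrite pg.
  have := leq_trans xs (size_polyD _ _); rewrite leq_max ltnNge px /= => xq.
  by rewrite (qg x)// orbT.
Qed.

Lemma covers_scale L p (c : S) : 0 < c -> covers L p -> covers L (c *: p).
Proof.
move=> c0 [p0 pL pg]; split.
- by move=> i; rewrite coefZ mulr_ge0// ltW.
- by move=> x; rewrite /supp /= coefZ mulf_eq0 negb_or => /andP[_ /pL].
- have cn : c != 0 by rewrite gt_eqF.
  by move=> x Lx; rewrite size_scale// => /(pg _ Lx) px; rewrite coefZ mulf_neq0.
Qed.

Lemma covers_min L p : covers L p -> unbounded L -> p != 0 ->
  (minelt L < size p)%N /\ p`_(minelt L) != 0.
Proof.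
move=> [p0 pL pg] uL np; have [Lm mL] := mineltP uL.
have ms : (minelt L < size p)%N.
  have pl : supp p (size p).-1 by rewrite /supp /= -lead_coefE lead_coef_eq0.
  by apply: (leq_ltn_trans (mL _ (pL _ pl))); exact: supp_ltn.
by split=> //; exact: pg.
Qed.

End Covers.

Section Averages.
Context {R : realType} {k : scalar_kind} {K : metricType R}.
Context {cK : compact [set: K]}.
Local Notation S := (scalars R k).
Variables (s : omega1 -> nat -> omega1) (f : nat -> CK k cK) (N0 : set nat).
Hypothesis hs : associated_sequences s.
Hypothesis f_norm : normalized_seq f.
Hypothesis coef_le :
  forall p : {poly S}, supp p `<=` N0 -> forall i, av p`_i <= 4 * nrm f p.

Lemma nrm_gt0 (p : {poly S}) : supp p `<=` N0 -> p != 0 -> 0 < nrm f p.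
Proof.
move=> pN0 p0; rewrite lt_neqAle nrm_ge0 andbT eq_sym; apply/eqP => n0.
move/eqP: p0; apply; apply/polyP => i; rewrite coef0; apply: av_eq0.
by apply: le_anti; rewrite av_ge0 andbT (le_trans (coef_le pN0 i))// n0 mulr0.
Qed.

(** The invariant of the transfinite recursion. The last clause is a continuity property: the block
    depends only on the part of [L] below its size. All gluing and openness arguments rest on it. *)
Definition regular (F : set nat -> {poly S}) := forall L, infsub L N0 ->
  [/\ covers L (F L), nrm f (F L) = 1 &
      forall L', infsub L' N0 -> (forall x, (x < size (F L))%N -> L x <-> L' x) ->
        F L' = F L].

Section Regular.
Variable F : set nat -> {poly S}.
Hypothesis F_reg : regular F.

Lemma reg_neq0 L : infsub L N0 -> F L != 0.
Proof.
move=> /F_reg[_ n1 _]; apply/eqP => F0; move: n1; rewrite F0 nrm0 => /esym/eqP.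
by rewrite oner_eq0.
Qed.

Lemma infsub_above0 L n : infsub L N0 -> infsub (above L n) N0.
Proof. by move=> LN; apply: (infsub_trans _ LN); apply: infsub_above; case: LN. Qed.

Lemma reg_size_ge L n : infsub L N0 -> (forall x, L x -> (n <= x)%N) ->
  (n < size (F L))%N.
Proof.
move=> LN nL; have [cov _ _] := F_reg LN.
have [ms _] := covers_min cov LN.2 (reg_neq0 LN).
by apply: leq_ltn_trans ms; apply: nL; case: (mineltP LN.2).
Qed.

Lemma tailset_infsub L n : infsub L N0 -> infsub (tailset F L n) L.
Proof.
move=> LN; case: n => [|n] /=; first by apply: infsub_refl; case: LN.
by rewrite beyondE; apply: infsub_above; case: LN.
Qed.

Lemma tailset_infsub0 L n : infsub L N0 -> infsub (tailset F L n) N0.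
Proof. by move=> LN; apply: (infsub_trans _ LN); exact: tailset_infsub. Qed.

(** The definition of [tailset] cuts at the last block, whereas inductions need to remove the first
    one. Both cuts agree because the sizes of the blocks increase. *)
Lemma tailsetS L n : infsub L N0 ->
  tailset F L n.+1 = tailset F (above L (size (F L))) n.
Proof.
move=> LN; elim: n => [|n IH]; first by rewrite /= beyondE.
rewrite [LHS]/= -/(tailset F L n.+1) IH /= !beyondE.
set L' := above L (size (F L)); set q := F (tailset F L' n).
have L'N : infsub L' N0 by exact: infsub_above0.
have zq : (size (F L) < size q)%N.
  apply: reg_size_ge; first exact: tailset_infsub0.
  by move=> x /(tailset_infsub _ L'N).1[].
apply/seteqP; split=> x; rewrite /L' /above /=; last by move=> [[? ?] ?].
by move=> [Lx qx]; split=> //; split=> //; exact: leq_trans (ltnW zq) qx.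
Qed.

Lemma consecutive0 L : consecutive F L 0 = F L. Proof. by []. Qed.

Lemma consecutiveS L i : infsub L N0 ->
  consecutive F L i.+1 = consecutive F (above L (size (F L))) i.
Proof. by move=> LN; rewrite /consecutive tailsetS. Qed.

Lemma consecutive_local L L' m n : infsub L N0 -> infsub L' N0 ->
  (forall i, (i < m)%N -> (size (consecutive F L i) <= n)%N) ->
  (forall x, (x < n)%N -> L x <-> L' x) ->
  forall i, (i < m)%N -> consecutive F L' i = consecutive F L i.
Proof.
elim: m L L' => // m IH L L' LN L'N Ln LL' i im.
have [_ _ loc] := F_reg LN.
have FE : F L' = F L.
  apply: loc => // x xF; apply: LL'; apply: (leq_trans xF).
  exact: (Ln 0%N).
case: i im => [_|i]; first exact: FE.
rewrite ltnS => im; rewrite !consecutiveS// FE.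
apply: IH => //; try exact: infsub_above0.
  by move=> j jm; rewrite -consecutiveS//; apply: Ln.
by move=> x xn; rewrite /above /=; split=> -[Lx ?]; split=> //; apply/(LL' x xn).
Qed.

(** [L] is the union of the supports. The support of [v m] is an initial segment both of the union
    [U m] of the supports from [m] on and of the set that produced [v m]; by regularity [F] takes
    the same value on both. *)
Lemma glue_blocks (N : set nat) n (v : nat -> {poly S}) : infsub N N0 ->
  (forall j, exists2 L,
     infsub L (above N (if j is j'.+1 then size (v j') else n)) & v j = F L) ->
  exists2 L, infsub L (above N n) & forall j, consecutive F L j = v j.
Proof.
move=> NN0 vP.
have sub0 L m : infsub L (above N m) -> infsub L N0.
  by move=> LN; apply: infsub_trans LN (infsub_above0 _ NN0).
have vcov j : exists L, [/\ infsub L (above N (if j is j'.+1 then size (v j') else n)),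
    v j = F L & covers L (v j)].
  have [L LN vE] := vP j; exists L; split=> //; rewrite vE.
  by have [] := F_reg (sub0 _ _ LN).
have start j x : supp (v j.+1) x -> (size (v j) <= x)%N.
  by have [L [LN _ [_ vL _]]] := vcov j.+1 => /vL/LN.1[].
have size_lt j : (size (v j) < size (v j.+1))%N.
  have [L LN ->] := vP j.+1; apply: reg_size_ge; first exact: sub0 LN.
  by move=> x /LN.1[].
have size_le i j : (i <= j)%N -> (size (v i) <= size (v j))%N.
  move=> /subnK <-; elim: (j - i)%N => // d IH; apply: (leq_trans IH).
  exact: ltnW (size_lt _).
have size_ge j : (j <= size (v j))%N.
  by elim: j => // j IH; exact: leq_ltn_trans IH (size_lt j).
pose U m := [set x | exists2 j, (m <= j)%N & supp (v j) x].
have uU m : unbounded (U m).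
  move=> l; have [x vx] : exists x, supp (v (maxn l m).+1) x.
    exists (size (v (maxn l m).+1)).-1; rewrite /supp /= -lead_coefE lead_coef_eq0.
    by have [L [LN -> _]] := vcov (maxn l m).+1; rewrite reg_neq0//; exact: sub0 LN.
  exists x; last by exists (maxn l m).+1 => //; rewrite leqW// leq_maxr.
  apply: leq_trans (start _ _ vx); apply: leq_trans (size_ge _).
  exact: leq_maxl.
have UN m : infsub (U m) N.
  split=> // x [j _ vx]; have [L [LN _ [_ vL _]]] := vcov j.
  by have [] := LN.1 _ (vL _ vx).
have UN0 m : infsub (U m) N0 by exact: infsub_trans NN0.
have FU m : F (U m) = v m.
  have [L [LN vE [_ vL vg]]] := vcov m; have [_ _ loc] := F_reg (sub0 _ _ LN).
  rewrite vE; apply: loc => // x; rewrite -vE => xv; split=> [Lx|].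
    by exists m => //; exact: vg.
  move=> [j mj vx]; move: mj; rewrite leq_eqVlt => /predU1P[mj|].
    by apply: vL; rewrite mj.
  case: j vx => // j vx; rewrite ltnS => /size_le.
  by move=> /leq_trans/(_ (start _ _ vx)); rewrite leqNgt xv.
exists (U 0%N).
  split=> // x; move=> [j _ vx]; split; first by apply: (UN 0%N).1; exists j.
  elim: j x vx => [|j IH] x vx.
    by have [L [LN _ [_ vL _]]] := vcov 0%N; have [] := LN.1 _ (vL _ vx).
  have [y vy] : exists y, supp (v j) y.
    exists (size (v j)).-1; rewrite /supp /= -lead_coefE lead_coef_eq0.
    by have [L [LN -> _]] := vcov j; rewrite reg_neq0//; exact: sub0 LN.
  apply: (leq_trans (IH _ vy)); apply: leq_trans (start _ _ vx).
  exact/ltnW/supp_ltn.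
suff H i m : consecutive F (U m) i = v (m + i)%N by move=> j; rewrite H add0n.
elim: i m => [|i IH] m; first by rewrite addn0 consecutive0 FU.
rewrite consecutiveS// FU addnS -addSn -IH; congr (consecutive F _ i).
apply/seteqP; split=> x.
  move=> [[j mj vx] mx]; exists j => //; rewrite ltn_neqAle mj andbT.
  apply: contraTneq mx => ->; rewrite -ltnNge; exact: supp_ltn.
move=> [j mj vx]; split; first by exists j => //; exact: ltnW.
case: j mj vx => // j; rewrite ltnS => /size_le mj /start; exact: leq_trans.
Qed.

Definition bsum L m : {poly S} := \sum_(i < m) consecutive F L i.

Lemma bsumS L m : infsub L N0 ->
  bsum L m.+1 = F L + bsum (above L (size (F L))) m.
Proof.
move=> LN; rewrite /bsum big_ord_recl; congr (_ + _).
by apply: eq_bigr => i _; exact: consecutiveS.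
Qed.

Lemma covers_bsum L m : infsub L N0 -> covers L (bsum L m).
Proof.
elim: m L => [|m IH] L LN.
  by rewrite /bsum big_ord0; split=> [i|x|x _]; rewrite ?coef0 ?size_poly0// /supp/= coef0 eqxx.
rewrite bsumS//; apply: covers_add; first by have [] := F_reg LN.
exact/IH/infsub_above0.
Qed.

Lemma bsum_neq0 L m : infsub L N0 -> bsum L m.+1 != 0.
Proof.
move=> LN; rewrite -size_poly_gt0 bsumS//.
have [[F0 _ _] _ _] := F_reg LN.
have [q0 _ _] := covers_bsum m (infsub_above0 (size (F L)) LN).
by apply: leq_trans (size_nonneg_addl F0 q0); rewrite size_poly_gt0 reg_neq0.
Qed.

Lemma size_bsum_ge L m i : infsub L N0 -> (i < m)%N ->
  (size (consecutive F L i) <= size (bsum L m))%N.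
Proof.
move=> LN im; rewrite /bsum (bigD1 (Ordinal im))//=; apply: size_nonneg_addl.
  by move=> j; have [[]] := F_reg (tailset_infsub0 i LN).
move=> j; rewrite coef_sum; apply: sumr_ge0 => l _.
by have [[]] := F_reg (tailset_infsub0 l LN).
Qed.

End Regular.

Definition first a (L : set nat) : {poly S} := avg s f a L 0%N.

Lemma first_zero a L : is_zero a -> first a L = 'X^(minelt L).
Proof. by move=> a0; rewrite /first avg_zero. Qed.

Lemma regular_zero a : is_zero a -> regular (first a).
Proof.
move=> a0 L LN; rewrite first_zero//; have [Lm mL] := mineltP LN.2; split.
- split=> [i|x|x Lx]; rewrite ?size_polyXn /supp /= ?coefXn ?ler0n//.
    by case: (eqVneq x (minelt L)) => [->//|_]; rewrite eqxx.
  by rewrite ltnS => xm; rewrite (_ : x = minelt L) ?eqxx ?oner_eq0//; have := mL x Lx; lia.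
- exact: nrmX.
- move=> L' L'N; rewrite size_polyXn => LL'; rewrite first_zero//; congr ('X^_).
  apply: minelt_eq; first exact/LL'.
  move=> l L'l; rewrite leqNgt; apply/negP => lm.
  by have /(LL' _ (leqW lm))/mL := L'l; rewrite leqNgt lm.
Qed.

(** This is the definition at successors and limits. At zero, removing the least element of [L]
    amounts to passing beyond the block ['X^(minelt L)]. *)
Lemma avg_consecutive a L n : infsub L N0 ->
  avg s f a L n = consecutive (first a) L n.
Proof.
have [a0|[b ->]|al] := omega1_cases a; last 2 first.
- move=> _; rewrite avg_osucc; congr consecutive; apply/funext => L'.
  by rewrite /first avg_osucc.
- move=> _; rewrite avg_is_limit//; congr consecutive; apply/funext => L'.
  by rewrite /first avg_is_limit.
have reg := regular_zero a0.
rewrite avg_zero//; elim: n L => [|n IH] L LN; first by rewrite consecutive0 first_zero.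
rewrite consecutiveS// -IH; last exact: infsub_above0.
congr ('X^_); rewrite /nthelt iterSr; congr (minelt (iter n _ _)).
have [Lm mL] := mineltP LN.2.
rewrite first_zero// size_polyXn; apply/seteqP; split=> x.
  move=> [Lx /eqP xm]; split=> //; have := mL x Lx; lia.
by move=> [Lx mx]; split=> // xm; rewrite xm ltnn in mx.
Qed.

Lemma first_succ b L : infsub L N0 ->
  first (osucc b) L = unitize f (bsum (first b) L (minelt L).+1).
Proof.
move=> LN; rewrite /first avg_osucc /consecutive /= /avg_succ; congr unitize.
by apply: eq_bigr => i _; exact: avg_consecutive.
Qed.

Lemma first_limit a L : is_limit a -> infsub L N0 -> (0 < minelt L)%N ->
  first a L = unitize f ((minelt L).+1%:R^-1 *: 'X^(minelt L) +
    first (s a (minelt L)) (above L (minelt L).+1)).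
Proof.
move=> al LN m0; rewrite /first avg_is_limit// /consecutive /= /avg_limit.
rewrite gtn_eqF//; congr (unitize f (_ + avg _ _ _ _ _)).
have [Lm mL] := mineltP LN.2; apply/seteqP; split=> x.
  move=> [Lx /eqP xm]; split=> //; have := mL x Lx; lia.
by move=> [Lx mx]; split=> // xm; rewrite xm ltnn in mx.
Qed.

Lemma first_limit0 a L : is_limit a -> minelt L = 0%N -> first a L = 'X^0.
Proof.
by move=> al m0; rewrite /first avg_is_limit// /consecutive /= /avg_limit m0.
Qed.

Lemma nrm_covers L p : infsub L N0 -> covers L p -> p != 0 -> 0 < nrm f p.
Proof. by move=> LN [_ pL _]; apply: nrm_gt0 => x /pL/LN.1. Qed.

Lemma covers_unitize L p : infsub L N0 -> covers L p -> p != 0 ->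
  covers L (unitize f p).
Proof.
move=> LN cp p0; rewrite unitizeE; apply: covers_scale => //.
by rewrite invr_gt0 -(@emb0 R k) emb_lt (nrm_covers LN).
Qed.

Lemma size_unitize L p : infsub L N0 -> covers L p -> p != 0 ->
  size (unitize f p) = size p.
Proof.
move=> LN cp p0; rewrite unitizeE size_scale// invr_eq0 gt_eqF//.
by rewrite -(@emb0 R k) emb_lt (nrm_covers LN).
Qed.

(** The least element of [L] lies in the support of the sum, so a set agreeing with [L] below the
    size of the sum has the same number of summands. *)
Lemma regular_succ b : regular (first b) -> regular (first (osucc b)).
Proof.
move=> reg L LN; rewrite first_succ//; set q := bsum _ _ _.
have cq : covers L q by exact: covers_bsum.
have q0 : q != 0 by exact: bsum_neq0.
have [Lm mL] := mineltP LN.2.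
split; first exact: covers_unitize.
- by rewrite nrm_unitize// gt_eqF// (nrm_covers LN).
- move=> L' L'N; rewrite (size_unitize LN)// => LL'; rewrite first_succ//.
  have [ms _] := covers_min cq LN.2 q0.
  have mE : minelt L' = minelt L.
    apply: minelt_eq; first exact/LL'.
    move=> l L'l; rewrite leqNgt; apply/negP => lm.
    by have /(LL' _ (ltn_trans lm ms))/mL := L'l; rewrite leqNgt lm.
  rewrite mE; congr unitize; apply: eq_bigr => i _.
  apply: (@consecutive_local _ reg L L' (minelt L).+1 (size q)) => // j jm.
  exact: size_bsum_ge.
Qed.

Lemma limit_block L m (q : {poly S}) : infsub L N0 -> m = minelt L -> covers (above L m.+1) q ->
  q != 0 -> let p := m.+1%:R^-1 *: 'X^m + q in
  [/\ covers L p, p != 0 & (size q <= size p)%N].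
Proof.
move=> LN mE cq q0 p; have [Lm mL] := mineltP LN.2; rewrite -mE in Lm mL.
have c0 : 0 < m.+1%:R^-1 :> S by rewrite invr_gt0.
have sX : size (m.+1%:R^-1 *: 'X^m : {poly S}) = m.+1.
  by rewrite size_scale ?gt_eqF// size_polyXn.
have cX : covers L (m.+1%:R^-1 *: 'X^m : {poly S}).
  apply: covers_scale => //; split=> [i|x|x Lx]; rewrite ?size_polyXn /supp /= ?coefXn ?ler0n//.
    by case: (eqVneq x m) => [->//|_]; rewrite eqxx.
  by rewrite ltnS => xm; rewrite (_ : x = m) ?eqxx ?oner_eq0//; have := mL x Lx; lia.
have qp : (size q <= size p)%N.
  by rewrite /p addrC; apply: size_nonneg_addl; [case: cq|case: cX].
split=> //; first by apply: covers_add => //; rewrite sX.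
by rewrite -size_poly_gt0 (leq_trans _ qp)// size_poly_gt0.
Qed.

Lemma regular_limit a : is_limit a -> (forall b, (b < a)%O -> regular (first b)) ->
  regular (first a).
Proof.
move=> al IH L LN; have [Lm mL] := mineltP LN.2.
have mE L' n : infsub L' N0 -> (minelt L < n)%N ->
    (forall x, (x < n)%N -> L x <-> L' x) -> minelt L' = minelt L.
  move=> L'N mn LL'; apply: minelt_eq; first exact/LL'.
  move=> l L'l; rewrite leqNgt; apply/negP => lm.
  by have /(LL' _ (ltn_trans lm mn))/mL := L'l; rewrite leqNgt lm.
have [m0|m0] := posnP (minelt L).
  rewrite (first_limit0 al m0); split.
  - split=> [i|x|x Lx]; rewrite ?size_polyXn /supp /= ?coefXn ?ler0n//.
      by case: (eqVneq x 0%N) => [->|_]; rewrite ?eqxx -?m0.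
    by rewrite ltnS leqn0 => ->; rewrite oner_eq0.
  - exact: nrmX.
  - move=> L' L'N; rewrite size_polyXn => LL'; apply: first_limit0 => //.
    by rewrite (mE L' 1%N)// m0.
rewrite first_limit//.
have reg := IH _ (limit_lt (minelt L) hs al).
have aN := infsub_above0 (minelt L).+1 LN.
have [cq _ loc] := reg _ aN.
have [cp p0 qp] := limit_block LN erefl cq (reg_neq0 reg aN).
have [ms _] := covers_min cp LN.2 p0.
split; first exact: covers_unitize.
- by rewrite nrm_unitize// gt_eqF// (nrm_covers LN).
- move=> L' L'N; rewrite (size_unitize LN)// => LL'.
  have mE' := mE L' _ L'N ms LL'.
  rewrite first_limit// mE'//; congr (unitize f (_ + _)); apply: loc.
    exact: infsub_above0.
  move=> x xq; have LL := LL' x (leq_trans xq qp).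
  by split=> -[Lx ?]; split=> //; apply/LL.
Qed.

Lemma regular_first a : regular (first a).
Proof.
elim/omega1_ind: a => a IH.
have [a0|[b ab]|al] := omega1_cases a; first exact: regular_zero.
  by rewrite ab; apply/regular_succ/IH; rewrite ab lt_osucc.
exact: regular_limit.
Qed.

End Averages.

(** * Dense properties of pairs of an ordinal and an infinite set *)

Definition almost_sub (N' N : set nat) := exists n, above N' n `<=` N.

(** Asking for all infinite subsets of [N''] makes the property hereditary, as diagonalization
    requires. *)
Definition dense_in (N : set nat) (P : set nat -> Prop) := forall N', infsub N' N ->
  exists2 N'', infsub N'' N' & forall L, infsub L N'' -> P L.

Lemma almost_sub_sub N' N : N' `<=` N -> almost_sub N' N.
Proof. by move=> NN; exists 0%N => x [/NN]. Qed.

Lemma almost_sub_above N n : almost_sub N (above N n).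
Proof. by exists n. Qed.

Lemma dense_in_almost N N' P : almost_sub N' N -> dense_in N P -> dense_in N' P.
Proof.
move=> [n nN] dP M' M'N'; have uM' := M'N'.2.
have [|N'' N''M P''] := dP (above M' n).
  by split; [move=> x [/M'N'.1 N'x nx]; apply: nN|exact: unbounded_above].
by exists N'' => //; exact: infsub_trans N''M (infsub_above _ uM').
Qed.

Definition upward (P : omega1 -> set nat -> Prop) := forall a a' N N',
  P a N -> (a <= a')%O -> almost_sub N' N -> P a' N'.

Definition cofinal (a0 : omega1) (N0 : set nat) (P : omega1 -> set nat -> Prop) :=
  forall a N, (a0 <= a)%O -> infsub N N0 ->
  exists a' N', [/\ (a <= a')%O, infsub N' N & P a' N'].

(** Treating the properties in turn gives increasing ordinals and decreasing sets. A supremum of the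
    ordinals and a pseudo-intersection of the sets lie beyond all stages, the latter up to finite
    sets, whence the almost inclusion in [upward]. *)
Lemma cofinal_countable a0 N0 (P : nat -> omega1 -> set nat -> Prop) :
  (forall i, upward (P i)) -> (forall i, cofinal a0 N0 (P i)) ->
  cofinal a0 N0 (fun a N => forall i, P i a N).
Proof.
move=> Pup Pcof a N a0a NN0.
have [] := @dependent_choice_in (omega1 * set nat)
  (fun _ x => (a0 <= x.1)%O /\ infsub x.2 N0)
  (fun i x y => [/\ (x.1 <= y.1)%O, infsub y.2 x.2 & P i y.1 y.2]) (a, N) (conj a0a NN0).
  move=> i [b L] [/= a0b LN0]; have [b' [L' [bb' L'L PL']]] := Pcof i b L a0b LN0.
  exists (b', L'); split=> //; split; first exact: le_trans bb'.
  exact: infsub_trans LN0.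
move=> u [u0 uP].
have [b bP] := omega1_sup (fun i => (u i).1).
have [||L LN LP] := @pseudo_intersection (fun i => (u i).2).
- by move=> j; case: (uP j) => -[_ []].
- by move=> j; case: (uP j) => _ [_ []].
exists b, L; split.
- by have := bP 0%N; rewrite u0.
- by rewrite u0 in LN.
- move=> i; have [_ [_ _ Pi]] := uP i; apply: Pup Pi (bP _) _.
  have [m im Lm] := LN.2 i; exists m.+1; apply: (subset_trans (LP m Lm)).
  have: (i.+1 <= m.+1)%N by [].
  move=> /subnK <-; elim: (m.+1 - i.+1)%N => // d IH x.
  by case: (uP (d + i.+1)%N) => _ [_ [+ _] _] => /[apply]; exact: IH.
Qed.

(** * Averages whose sums grow become small *)

Section Growth.
Context {R : realType} {k : scalar_kind} {K : metricType R}.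
Context {cK : compact [set: K]}.
Local Notation S := (scalars R k).
Variables (s : omega1 -> nat -> omega1) (f : nat -> CK k cK) (N0 : set nat).
Variables (eps : nat -> S) (tail : nat -> R).
Hypothesis hs : associated_sequences s.
Hypothesis f_norm : normalized_seq f.
Hypothesis eps_gt0 : forall n, 0 < eps n.
Hypothesis tail_ge0 : forall n, 0 <= tail n.
Hypothesis tailE : forall n, tail n = re (eps n) + tail n.+1.
Hypothesis tail_to0 :
  forall d : R, 0 < d -> exists n0, forall n, (n0 <= n)%N -> tail n <= d.
Hypothesis coef_le :
  forall p : {poly S}, supp p `<=` N0 -> forall i, av p`_i <= 4 * nrm f p.
Hypothesis take_le1 : forall d : R, 0 < d -> exists n0, forall p : {poly S},
  supp p `<=` N0 -> (forall i, (i < n0)%N -> p`_i = 0) -> forall j,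
  nrm f (take_poly j p) <= (1 + d) * nrm f p.
Hypothesis f_small :
  forall t : K, finite_set [set n | N0 n /\ eps n <= `|f n t|].

Local Notation A := (first s f).
Let reg a : regular f N0 (A a) := regular_first hs f_norm coef_le a.

(** The sets $K_s$ are the finite intersections of these. *)
Definition peak n : set K := [set t | re (eps n) <= av (f n t)].

(** This is $\nu(b,L)$, the factor by which the first [osucc b]-average of [L] is normalized. *)
Definition growth b L := nrm f (bsum (A b) L (minelt L).+1).

Definition small a N (X : set K) (c : R) :=
  dense_in N (fun L => forall t, X t -> av (ev f (A a L) t) <= c).

Lemma first_nrm a L : infsub L N0 -> nrm f (A a L) = 1.
Proof. by move=> /(reg a)[]. Qed.

Lemma first_coef_le a L i : infsub L N0 -> av (A a L)`_i <= 4.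
Proof.
move=> LN; have [[_ sL _] n1 _] := reg a LN.
have := @coef_le (A a L) _ i; rewrite n1 mulr1; apply=> x /sL; exact: LN.1.
Qed.

Lemma take_bsum b L m : infsub L N0 ->
  take_poly (size (A b L)) (bsum (A b) L m.+1) = A b L.
Proof.
move=> LN; rewrite (bsumS (reg b))// take_polyD take_poly_id//.
rewrite [X in _ + X](_ : _ = 0) ?addr0//; apply/polyP => i.
rewrite coef_take_poly coef0; case: ltnP => // ib.
have [_ sL _] := covers_bsum (reg b) m (infsub_above0 (size (A b L)) LN).
apply/eqP; apply: contraT => /sL[_]; by rewrite leqNgt ib.
Qed.

(** The first summand has norm 1 and is an initial projection of the whole sum; far out, such
    projections have norm at most [1 + d]. *)
Lemma growth_ge (d : R) : 0 < d -> exists g, forall b L, infsub L N0 ->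
  (forall x, L x -> (g <= x)%N) -> 1 <= (1 + d) * growth b L.
Proof.
move=> /take_le1[g gP]; exists g => b L LN gL.
have [_ sL _] := covers_bsum (reg b) (minelt L).+1 LN.
have := gP (bsum (A b) L (minelt L).+1) _ _ (size (A b L)).
rewrite take_bsum// first_nrm//; apply.
  by move=> x /sL/LN.1.
by move=> i ig; apply/eqP; apply: contraT => /sL/gL; rewrite leqNgt ig.
Qed.

(** If the support of the first block contains no [n] with [t] in [peak n], the block is bounded by
    the tail of [eps] and the induction goes on. Otherwise it contributes at most [c], and all later
    blocks are at most [e n <= D] by [he]. So [c] is paid only once. *)
Lemma ev_bsum_le b N (X : set K) (c D : R) (e : nat -> R) : infsub N N0 -> 0 <= D ->
  0 <= c ->
  (forall L t, infsub L N -> X t -> av (ev f (A b L) t) <= c) ->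
  (forall n L t, N n -> infsub L (above N n.+1) -> X t -> peak n t ->
     av (ev f (A b L) t) <= e n) ->
  forall m L g t, infsub L N -> (forall x, L x -> (g <= x)%N) ->
    (forall n, L n -> e n <= D) -> X t ->
    av (ev f (bsum (A b) L m) t) <= 4 * tail g + c + m%:R * D.
Proof.
move=> NN0 D0 c0 hc he; elim=> [|m IH] L g t LN gL eD Xt.
  by rewrite /bsum big_ord0 ev0 av0 mul0r addr0 addr_ge0// mulr_ge0.
have LN0 : infsub L N0 by exact: infsub_trans NN0.
rewrite (bsumS (reg b))//; set p := A b L; set L' := above L _.
have [[_ sL _] n1 _] := reg b LN0.
have L'L : infsub L' L by apply: infsub_above; case: LN.
have L'N : infsub L' N by exact: infsub_trans LN.
have L'N0 : infsub L' N0 by exact: infsub_trans NN0.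
rewrite evD (le_trans (avD _ _))//.
have [[n [pn Yn]]|noY] := pselect (exists n, supp p n /\ peak n t).
  have Ln := sL _ pn.
  have qD : av (ev f (bsum (A b) L' m) t) <= m%:R * D.
    rewrite /bsum ev_sum (le_trans (av_sum _ _ _))//.
    have -> : m%:R * D = \sum_(i < m) D by rewrite sumr_const card_ord mulr_natl.
    apply: ler_sum => i _; rewrite (le_trans _ (eD _ Ln))//.
    apply: he => //; first exact: LN.1.
    have T := tailset_infsub (A b) i L'N0.
    split; last by case: T.
    move=> x /T.1[Lx px]; split; first exact: LN.1.
    exact: leq_trans (supp_ltn pn) px.
  have pc : av (ev f p t) <= c by exact: hc.
  have tg : 0 <= 4 * tail g by rewrite mulr_ge0.
  rewrite -natr1 mulrDl; lra.
have gp : (g <= size p)%N by apply/ltnW/(reg_size_ge (reg b)).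
have pe : av (ev f p t) <= 4 * (tail g - tail (size p)).
  apply: (ev_eps_le eps_gt0 tailE) => // [i|i pi]; first exact: first_coef_le.
  split; [exact/gL/sL|exact: supp_ltn|].
  by rewrite leNgt; apply/negP => lt_e; apply: noY; exists i; split=> //; exact: ltW.
have := IH L' (size p) t L'N (fun x => @proj2 _ _) (fun n Ln => eD n (L'L.1 n Ln)) Xt.
rewrite -natr1 mulrDl; lra.
Qed.

(** The sum of the [b]-averages is barely larger than [c] on [X], and normalization divides it by at
    least [kap]. *)
Lemma small_succ b N (X : set K) (c kap d : R) : infsub N N0 -> 0 <= c -> 0 < kap ->
  0 < d -> (forall n e, N n -> 0 < e -> small b N (X `&` peak n) e) ->
  (forall L, infsub L N -> kap <= growth b L) ->
  small b N X c -> small (osucc b) N X (c / kap + d).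
Proof.
move=> NN0 c0 kap0 d0 nul gr sm N1 N1N; have [N2 N2N1 N2c] := sm N1 N1N.
(* The error is five times [dd]: four from [4 * tail g], and one from the [(minelt L).+1] summands,
   each at most [e (minelt L)]. *)
pose dd := kap * d / 5%:R; have dd0 : 0 < dd by rewrite divr_gt0// mulr_gt0.
pose e n := dd / n.+1%:R; have e0 n : 0 < e n by rewrite divr_gt0.
have N2N := infsub_trans N2N1 N1N.
have [||N3 N3N2 N3P] := @diagonal_dense (fun n L => N n -> forall L', infsub L' L ->
  forall t, (X `&` peak n) t -> av (ev f (A b L') t) <= e n) N2 N2N.2.
- by move=> n L L' L'L DL Nn L'' L''L'; apply: DL => //; exact: infsub_trans L'L.
- move=> n L LN2; have [Nn|Nn] := pselect (N n); last first.
    by exists L => //; apply: infsub_refl; case: LN2.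
  have [|L' L'L L'P] := nul n (e n) Nn (e0 n) L; first exact: infsub_trans N2N.
  by exists L'.
have N3N := infsub_trans N3N2 N2N; have N3N0 := infsub_trans N3N NN0.
have [g gP] := tail_to0 dd0.
exists (above N3 g).
  exact: infsub_trans (infsub_above _ N3N.2) (infsub_trans N3N2 N2N1).
move=> L LN t Xt; have [Lm mL] := mineltP LN.2.
have LN3 : infsub L N3 by apply: infsub_trans LN (infsub_above _ N3N.2).
have LNN : infsub L N by exact: infsub_trans N3N.
have LN0 : infsub L N0 by exact: infsub_trans NN0.
rewrite (first_succ hs f_norm b LN0) av_ev_unitize -/(growth b L).
have bd : av (ev f (bsum (A b) L (minelt L).+1) t) <=
    4 * tail g + c + (minelt L).+1%:R * e (minelt L).
  apply: (@ev_bsum_le b N3 X c (e (minelt L)) e) => //.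
  - exact: ltW.
  - by move=> L' t' L'N3 Xt'; apply: N2c => //; exact: infsub_trans N3N2.
  - move=> n L' t' N3n L'N Xt' Yt'; apply: (N3P n N3n n) => //; exact: N3N.1.
  - by move=> x /LN.1[].
  - by move=> n /mL mn; rewrite ler_pM2l// lef_pV2 ?posrE// ler_nat.
have gk : kap <= growth b L by exact: gr.
rewrite ler_pdivrMr ?(lt_le_trans kap0)//.
apply: (@le_trans _ _ ((c / kap + d) * kap)); last first.
  by rewrite ler_wpM2l// addr_ge0 ?divr_ge0// ltW.
apply: (le_trans bd); rewrite [leRHS]mulrDl divfK ?gt_eqF//.
have -> : (minelt L).+1%:R * e (minelt L) = dd by rewrite /e mulrC divfK.
have tg := gP g (leqnn g); have -> : d * kap = 5%:R * dd by rewrite /dd; field.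
lra.
Qed.

Lemma small_almost a N N' X c : almost_sub N' N -> small a N X c -> small a N' X c.
Proof. exact: dense_in_almost. Qed.

(** Here no growth is assumed: normalizing factors are almost at least 1 far out, so each step loses
    arbitrarily little, and the induction hypothesis is available for every positive loss. *)
Lemma small_persist b N (X : set K) (c : R) : infsub N N0 -> 0 <= c ->
  (forall n b' e, N n -> (b <= b')%O -> 0 < e -> small b' N (X `&` peak n) e) ->
  small b N X c -> forall b' d, (b <= b')%O -> 0 < d -> small b' N X (c + d).
Proof.
move=> NN0 c0 nul sm b'; elim/omega1_ind: b' => b' IH d bb' d0.
have d30 : 0 < d / 3%:R by rewrite divr_gt0.
move: bb'; rewrite le_eqVlt => /predU1P[<-|bb'].
  move=> N1 /sm[N2 N2N1 N2P]; exists N2 => // L /N2P LP t /LP; lra.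
have [b'0|[b'' b'E]|b'l] := omega1_cases b'.
- by have := b'0 b; rewrite leNgt bb'.
- have bb'' : (b <= b'')%O by rewrite -lt_osucc_le -b'E.
  have sm' : small b'' N X (c + d / 3%:R) by apply: IH => //; rewrite b'E lt_osucc.
  (* Division by a growth of at least $1/(1+h)$ costs a factor $1+h$; since $h(c+d)=d/3$, the total
     loss is at most three times $d/3$. *)
  pose h := d / (3%:R * (c + d)).
  have cd0 : 0 < c + d by lra.
  have h0 : 0 < h by rewrite divr_gt0// mulr_gt0.
  have [g gP] := growth_ge h0.
  have aN : infsub (above N g) N by apply: infsub_above; case: NN0.
  have := @small_succ b'' (above N g) X (c + d / 3%:R) (1 + h)^-1 (d / 3%:R).
  rewrite b'E; move=> ss.
  apply: (small_almost (almost_sub_above N g)).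
  suff : small (osucc b'') (above N g) X ((c + d / 3%:R) / (1 + h)^-1 + d / 3%:R).
    move=> ss1 N1 /ss1[N2 N2N1 N2P]; exists N2 => // L /N2P LP t /LP.
    move=> /le_trans; apply; rewrite invrK.
    have -> : (c + d / 3%:R) * (1 + h) = c + d / 3%:R + h * (c + d / 3%:R) by ring.
    have : h * (c + d / 3%:R) <= h * (c + d) by rewrite ler_wpM2l ?ltW//; lra.
    have -> : h * (c + d) = d / 3%:R by rewrite /h; field; lra.
    lra.
  apply: ss => //.
  + exact: infsub_trans NN0.
  + by rewrite addr_ge0// ltW.
  + by rewrite invr_gt0 addr_gt0.
  + move=> n e [Nn _] e0; apply: small_almost (nul n b'' e Nn bb'' e0).
    exact: almost_sub_sub aN.1.
  + move=> L LN; rewrite -[leLHS]mulr1 ler_pdivrMl ?addr_gt0//; apply: gP.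
      exact: infsub_trans LN (infsub_trans aN NN0).
    by move=> x /LN.1[].
  + exact: small_almost (almost_sub_sub aN.1) sm'.
- have [n0 n0P] := limit_cofinal hs b'l bb'.
  (* [r] bounds the coefficient $1/(m+1)$ of the extra term. From $r(1+c+d)=d/3$ follows
     $r+c+d/3\le(c+d)(1-r)$, where $1-r$ bounds the normalizing factor from below. *)
  move=> N1 N1N; pose r := d / (3%:R * (1 + c + d)).
  have cd0 : 0 < 1 + c + d by lra.
  have r0 : 0 < r by rewrite divr_gt0// mulr_gt0.
  have [g gP] := natSinv_le r0.
  have [||N3 N3N1 N3P] := @diagonal_dense (fun n L => (n0 <= n)%N ->
    forall L', infsub L' L -> forall t, X t ->
      av (ev f (A (s b' n) L') t) <= c + d / 3%:R) N1 N1N.2.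
  + by move=> n L L' L'L DL nn L'' L''L'; apply: DL => //; exact: infsub_trans L'L.
  + move=> n L LN1; have [nn|nn] := leqP n0 n; last first.
      by exists L => //; apply: infsub_refl; case: LN1.
    have [|L' L'L L'P] := IH _ (limit_lt n hs b'l) (d / 3%:R) (n0P _ nn) d30 L.
      exact: infsub_trans N1N.
    by exists L'.
  (* The bound 1 excludes the special clause for the least index, [n0] makes [s b' m] at least [b],
     and [g] makes $1/(m+1)$ at most [r]. *)
  exists (above N3 (maxn 1 (maxn n0 g))).
    exact: infsub_trans (infsub_above _ N3N1.2) N3N1.
  move=> L LN t Xt; have [Lm mL] := mineltP LN.2.
  have LN3 : infsub L N3 by apply: infsub_trans LN (infsub_above _ N3N1.2).
  have LN0 : infsub L N0 by exact: infsub_trans (infsub_trans LN3 N3N1) (infsub_trans N1N NN0).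
  have [N3m] := LN.1 _ Lm; rewrite !geq_max => /and3P[m1 n0m gm].
  rewrite (first_limit f hs b'l LN0 m1) av_ev_unitize; set m := minelt L in m1 n0m gm N3m *.
  set q := A _ _.
  have aL : infsub (above L m.+1) (above N3 m.+1).
    split; first by move=> x [/LN3.1 N3x mx].
    by apply: unbounded_above; case: LN.
  have qt : av (ev f q t) <= c + d / 3%:R by apply: (N3P m N3m m).
  have q1 : nrm f q = 1 by rewrite first_nrm//; exact: infsub_above0.
  have rm := gP m gm.
  have avm : av (m.+1%:R^-1 : S) = m.+1%:R^-1 by rewrite avV av_natr.
  have ft : av (f m t) <= 1 by rewrite -(nrmX f_norm m) -evX nrm_ub.
  have i0 : 0 <= m.+1%:R^-1 :> R by rewrite invr_ge0.
  have num : av (ev f (m.+1%:R^-1 *: 'X^m + q) t) <= r + (c + d / 3%:R).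
    rewrite evD evZ evX (le_trans (avD _ _))// lerD// avM avm.
    by rewrite -[leRHS]mulr1 ler_pM ?av_ge0.
  have r1 : r < 1 by rewrite /r ltr_pdivrMr ?mulr_gt0// mul1r; lra.
  have den : 1 - r <= nrm f (m.+1%:R^-1 *: 'X^m + q).
    have := nrmD f (m.+1%:R^-1 *: 'X^m + q) (- (m.+1%:R^-1 *: 'X^m)).
    rewrite addrAC subrr add0r q1 nrmN nrmZ (nrmX f_norm) avm mulr1 => le1.
    by rewrite lerBlDr (le_trans le1)// lerD2l.
  rewrite ler_pdivrMr; last by apply: lt_le_trans den; lra.
  apply: (@le_trans _ _ ((c + d) * (1 - r))); last by rewrite ler_wpM2l//; lra.
  apply: (le_trans num).
  have rE : r * (1 + c + d) = d / 3%:R by rewrite /r; field; lra.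
  have -> : (c + d) * (1 - r) = c + d - r * (1 + c + d) + r by ring.
  rewrite rE; lra.
Qed.

Lemma small_le a N X c c' : c <= c' -> small a N X c -> small a N X c'.
Proof.
move=> cc' sm N1 /sm[N2 N2N1 N2P]; exists N2 => // L /N2P LP t /LP.
by move=> /le_trans; apply.
Qed.

Definition null a N X := forall b e, (a <= b)%O -> 0 < e -> small b N X e.

Lemma null_upward X : upward (fun a N => null a N X).
Proof.
move=> a a' N N' nul aa' N'N b e a'b e0; apply: small_almost N'N _.
by apply: nul => //; exact: le_trans a'b.
Qed.

Lemma peak_closed n : closed (peak n).
Proof.
move=> t ct; rewrite /peak /= leNgt; apply/negP => lt_e.
have d0 : 0 < (emb (re (eps n) - av (f n t)) : S).
  by rewrite -(@emb0 R k) emb_lt subr_gt0.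
have := @CK_continuous _ _ _ _ (f n) t => /cvgrPdist_lt/(_ _ d0) nb.
have [u [/= pu fu]] := ct _ nb.
have : av (f n u) < re (eps n).
  rewrite -[f n u](subrK (f n t)) (le_lt_trans (avD _ _))// -ltrBrDr.
  by rewrite /av distrC -(@emb_lt R k) emb_re.
by rewrite ltNge pu.
Qed.

(** * Growth on a cofinal family contradicts normalization *)

Section Vanishing.
Variables (eta : R) (a0 : omega1) (N00 : set nat).
Hypothesis eta_gt0 : 0 < eta.
Hypothesis N00N0 : infsub N00 N0.
Hypothesis growing : cofinal a0 N00
  (fun b N => forall L, infsub L N -> 1 + eta <= growth b L).

Definition vanishes X := cofinal a0 N00 (fun a N => null a N X).

(** The induction step on the tree of the sets $K_s$. Each occurrence of growth multiplies the bound
    on [X] by $q=1/(1+\eta)$, and [small_persist] keeps the new bound for all larger ordinals. *)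
Lemma vanishes_step (X : set K) n0 :
  (forall n, (n0 <= n)%N -> N00 n -> vanishes (X `&` peak n)) -> vanishes X.
Proof.
move=> vX a N a0a NN00.
have [||a1 [N1 [aa1 N1N nul1]]] := @cofinal_countable a0 N00
  (fun i a N => (n0 <= i)%N -> N00 i -> null a N (X `&` peak i)) _ _ a N a0a NN00.
- move=> i b b' L L' nul bb' L'L ni N00i; apply: null_upward bb' L'L; exact: nul.
- move=> i b L a0b LN00; have [[ni N00i]|nN] := pselect ((n0 <= i)%N /\ N00 i).
    have [b' [L' [bb' L'L nul]]] := vX i ni N00i b L a0b LN00.
    by exists b', L'; split.
  exists b, L; split=> //; first by apply: infsub_refl; case: LN00.
  by move=> ni N00i; case: nN.
pose N2 := above N1 n0.
have N2N1 : infsub N2 N1 by apply: infsub_above; case: N1N.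
have N2N00 : infsub N2 N00 by exact: infsub_trans N2N1 (infsub_trans N1N NN00).
have a0a1 : (a0 <= a1)%O by exact: le_trans a0a aa1.
have nul2 n b L e : (a1 <= b)%O -> infsub L N2 -> L n -> 0 < e ->
    small b L (X `&` peak n) e.
  move=> a1b LN2 Ln e0; have [N1n nn] := LN2.1 _ Ln.
  apply: small_almost (nul1 n nn (N2N00.1 _ (LN2.1 _ Ln)) b e a1b e0).
  by apply: almost_sub_sub => x /LN2.1[].
pose q := (1 + eta)^-1.
have eta1 : 0 < 1 + eta by rewrite addr_gt0.
have q0 : 0 < q by rewrite invr_gt0.
have q1 : q < 1 by rewrite invf_lt1// ltrDl.
(* The bounds $q^i$ are reached cofinally one after the other; [cofinal_countable] then yields all
   of them at once, so the limit bound is 0. *)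
pose T i b L := forall b' d, (b <= b')%O -> 0 < d -> small b' L X (q ^+ i + d).
have Tup i : upward (T i).
  move=> b b' L L' TL bb' L'L b'' d b'b'' d0; apply: small_almost L'L _.
  by apply: TL => //; exact: le_trans b'b''.
have Tcof i : cofinal a1 N2 (T i).
  elim: i => [|i IH] b L a1b LN2.
    exists b, L; split=> //; first by apply: infsub_refl; case: LN2.
    move=> b' d bb' d0 L' L'L; exists L'; first by apply: infsub_refl; case: L'L.
    move=> L'' L''L' t Xt; apply: (le_trans (nrm_ub _ _ _)).
    rewrite first_nrm ?expr0 ?lerDl ?ltW//.
    exact: infsub_trans (infsub_trans L''L' L'L) (infsub_trans LN2 (infsub_trans N2N00 N00N0)).
  have [b1 [L1 [bb1 L1L T1]]] := IH b L a1b LN2.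
  have L1N2 := infsub_trans L1L LN2; have a1b1 := le_trans a1b bb1.
  have [b2 [L2 [b1b2 L2L1 gr]]] := growing (le_trans a0a1 a1b1) (infsub_trans L1N2 N2N00).
  have L2N2 := infsub_trans L2L1 L1N2; have a1b2 := le_trans a1b1 b1b2.
  have L2N0 := infsub_trans L2N2 (infsub_trans N2N00 N00N0).
  exists (osucc b2), L2; split.
  - exact: le_trans bb1 (le_trans b1b2 (le_osucc _)).
  - exact: infsub_trans L1L.
  - move=> b' d b2b' d0.
    have qi0 : 0 <= q ^+ i by rewrite exprn_ge0// ltW.
    have d20 : 0 < d / 2%:R by rewrite divr_gt0.
    have d40 : 0 < d / 4%:R by rewrite divr_gt0.
    have sm : small b2 L2 X (q ^+ i + d / 2%:R).
      by apply: small_almost (almost_sub_sub L2L1.1) _; exact: T1.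
    have c0 : 0 <= q ^+ i + d / 2%:R by rewrite addr_ge0// ltW.
    have := @small_succ b2 L2 X _ (1 + eta) (d / 4%:R) L2N0 c0 eta1 d40 _ gr sm.
    move=> /(_ (fun n e Ln e0 => nul2 n b2 L2 e a1b2 L2N2 Ln e0)) sm2.
    have c20 : 0 <= (q ^+ i + d / 2%:R) / (1 + eta) + d / 4%:R.
      by rewrite addr_ge0 ?divr_ge0// ltW.
    apply: (small_le _ (small_persist L2N0 c20 _ sm2 b2b' d40)).
      rewrite -/q exprSr mulrDl; have : d / 2%:R * q <= d / 2%:R by rewrite ler_piMr// ltW.
      lra.
    move=> n b'' e Ln b2b''; apply: nul2 => //.
    exact: le_trans a1b2 (le_trans (le_osucc _) b2b'').
have [b [L [a1b LN2 TL]]] := cofinal_countable Tup Tcof (lexx a1) (infsub_refl N2N1.2).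
exists b, L; split.
- exact: le_trans aa1 a1b.
- exact: infsub_trans LN2 (infsub_trans N2N1 N1N).
- move=> b' e bb' e0; have e20 : 0 < e / 2%:R by rewrite divr_gt0.
  have /cvgrPdist_lt/(_ _ e20)[i _ iP] : q ^+ n @[n --> \oo] --> 0.
    by apply: cvg_expr; rewrite ger0_norm ?ltW.
  have := iP i (leqnn i); rewrite /= sub0r normrN ger0_norm ?exprn_ge0 ?ltW// => qe.
  by apply: small_le (TL i b' (e / 2%:R) bb' e20); lra.
Qed.

Lemma not_growing : False.
Proof.
have v0 : vanishes set0.
  move=> a N a0a NN; exists a, N; split=> //; first by apply: infsub_refl; case: NN.
  by move=> b e ab e0 N' N'N; exists N' => //; apply: infsub_refl; case: N'N.
have vT : ~ vanishes setT.
  move=> /(_ a0 N00 (lexx _) (infsub_refl N00N0.2))[a [N [_ NN nul]]].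
  have half : 0 < 2%:R^-1 :> R by rewrite invr_gt0.
  have [L LN LP] := nul a _ (lexx _) half N (infsub_refl NN.2).
  have LN0 : infsub L N0 by exact: infsub_trans LN (infsub_trans NN N00N0).
  have := nrm_le (ltW half) (fun t => LP L (infsub_refl LN.2) t I).
  rewrite first_nrm//; lra.
(* A set that does not vanish has an intersection with some later peak that does not vanish.
   Iterated from the whole space, this gives decreasing intersections, nonempty because the empty
   set vanishes. *)
have [] := @dependent_choice_in (set K * nat) (fun _ x => ~ vanishes x.1)
  (fun _ x y => exists n, [/\ (x.2 <= n)%N, N00 n & y = (x.1 `&` peak n, n.+1)])
  (setT, 0%N) vT.
  move=> _ [X m] /= nX; apply: contrapT => nn; apply: nX.
  apply: (@vanishes_step _ m) => n mn N00n; apply: contrapT => vn; apply: nn.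
  by exists (X `&` peak n, n.+1); split=> //; exists n.
move=> u [u0 uP].
have /choice[t tP] j : exists t, (u j).1 t.
  have [nv _] := uP j; apply: contrapT => nt; apply: nv.
  rewrite (_ : (u j).1 = set0)//; apply/seteqP; split=> // x ux.
  by case: nt; exists x.
have /choice[n nP] j : exists n, [/\ ((u j).2 <= n)%N, N00 n &
  u j.+1 = ((u j).1 `&` peak n, n.+1)] by case: (uP j).
(* A cluster point of points of these intersections belongs to infinitely many peaks, against
   [f_small]. *)
have [x [_ xc]] := cK (fmap_proper_filter t eventually_filter) filterT.
have ulow j i : (u (j + i)%N).1 `<=` (u j).1.
  elim: i => [|i IH]; first by rewrite addn0.
  by rewrite addnS; have [_ _ ->] := nP (j + i)%N; move=> y [/IH].
have px j : peak (n j) x.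
  apply: peak_closed => B xB.
  have : (t @ \oo) (peak (n j)).
    exists j.+1 => // i /= ji; rewrite -(subnKC ji).
    have := ulow j.+1 (i - j.+1)%N _ (tP _); have [_ _ ->] := nP j.
    by case.
  by move=> tp; have [y [py By]] := xc _ _ tp xB; exists y.
suff ub : unbounded [set n | N0 n /\ eps n <= `|f n x|].
  exact: (infinite_unbounded _).2 ub (f_small x).
move=> m.
have nge j : (j <= n j)%N.
  have [jn _ _] := nP j; apply: leq_trans jn.
  elim: j {nP} (nP) => // j IH nP'; have [jn _ ->] := nP' j; rewrite ltnS.
  exact: leq_trans (IH nP') jn.
exists (n m) => //; split; first by have [_ /N00N0.1] := nP m.
by rewrite -re_leE ?(ltW (eps_gt0 _))//; exact: px.
Qed.

End Vanishing.

End Growth.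

(** * Chains of blocks *)

Section Chains.
Context {R : realType} {k : scalar_kind} {K : metricType R}.
Context {cK : compact [set: K]}.
Local Notation S := (scalars R k).
Variables (f : nat -> CK k cK) (N0 : set nat) (F : set nat -> {poly S}).
Hypothesis F_reg : regular f N0 F.
Implicit Types (ps qs : seq {poly S}) (N L : set nat).

(** A finite counterpart of the hypothesis of [glue_blocks]: each block comes from its own infinite
    set, beyond the preceding block. *)
Fixpoint chain N (n : nat) ps : Prop :=
  if ps is p :: ps' then
    (exists2 L, infsub L (above N n) & p = F L) /\ chain N (size p) ps'
  else True.

Definition chain_end n ps := last n [seq size (p : {poly S}) | p <- ps].

Lemma chain_cat N n ps qs :
  chain N n (ps ++ qs) <-> chain N n ps /\ chain N (chain_end n ps) qs.
Proof.
elim: ps n => [|p ps IH] n /=; first by split=> [|[]].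
by rewrite -/(chain_end (size p) ps); split=> [[? /IH[]]|[[? ?] ?]]; split=> //; apply/IH.
Qed.

Lemma chain_sub N N' n ps : N `<=` N' -> chain N n ps -> chain N' n ps.
Proof.
move=> NN'; elim: ps n => //= p ps IH n [[L LN pE] /IH ch]; split=> //.
by exists L => //; split; [move=> x /LN.1[/NN' N'x nx]|case: LN].
Qed.

Lemma chain_le N m n ps : (m <= n)%N -> chain N n ps -> chain N m ps.
Proof.
move=> mn; case: ps => //= p ps [[L LN pE] ch]; split=> //; exists L => //.
by split; [move=> x /LN.1[Nx /(leq_trans mn)]|case: LN].
Qed.

Lemma chain_above N m n ps : chain (above N m) n ps -> chain N m ps.
Proof.
case: ps => //= p ps [[L LN pE] ch]; split; last by apply: chain_sub ch => x [].
by exists L => //; split; [move=> x /LN.1[]|case: LN].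
Qed.

Lemma chain_size_lt N n p ps : infsub N N0 -> chain N n (p :: ps) -> (n < size p)%N.
Proof.
move=> NN0 [[L LN ->] _]; apply: (reg_size_ge F_reg).
  by apply: infsub_trans LN _; exact: infsub_above0.
by move=> x /LN.1[].
Qed.

(** Sizes increase along a chain, so dropping a block only weakens the condition on the next one.
    This allows selecting the blocks of a given sign. *)
Lemma chain_filter (a : pred {poly S}) N n ps : infsub N N0 ->
  chain N n ps -> chain N n [seq p <- ps | a p].
Proof.
move=> NN0; elim: ps n => //= p ps IH n ch; have np := chain_size_lt NN0 ch.
have [pE /IH chf] := ch; case: (a p) => //=.
exact: chain_le (ltnW np) chf.
Qed.

Lemma chain_supp N n ps i : infsub N N0 -> chain N n ps -> ~ N i ->
  (\sum_(p <- ps) p)`_i = 0.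
Proof.
move=> NN0; elim: ps n => [|p ps IH] n /=; first by rewrite big_nil coef0.
move=> [[L LN pE] ch] Ni; rewrite big_cons coefD (IH _ ch Ni) addr0.
have LN0 : infsub L N0 by apply: infsub_trans LN _; exact: infsub_above0.
have [[_ sL _] _ _] := F_reg LN0.
apply/eqP; apply: contraT; rewrite pE => /sL/LN.1[]//.
Qed.

Lemma mkseqS (T : Type) (h : nat -> T) n : mkseq h n.+1 = h 0%N :: mkseq (h \o succn) n.
Proof. by rewrite /mkseq /= (iotaDl 1 0 n) -map_comp. Qed.

Lemma chain_consecutive N n L m : infsub N N0 -> infsub L (above N n) ->
  chain N n (mkseq (consecutive F L) m).
Proof.
move=> NN0; elim: m L n => // m IH L n LN; rewrite mkseqS /=.
have LN0 : infsub L N0 by apply: infsub_trans LN _; exact: infsub_above0.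
split; first by exists L.
rewrite consecutive0 (@eq_mkseq _ _ (consecutive F (above L (size (F L))))).
  apply: IH; split; last by apply: unbounded_above; case: LN.
  by move=> x [/LN.1[]].
by move=> i /=; rewrite (consecutiveS F_reg).
Qed.

Lemma chain_nth N n ps j : chain N n ps -> (j < size ps)%N -> exists2 L,
  infsub L (above N (if j is j'.+1 then size (nth 0 ps j') else n)) & nth 0 ps j = F L.
Proof.
elim: ps j n => // p ps IH j n /= [pE ch]; case: j => [|j] //= js.
by have [L LN E] := IH j _ ch js; exists L => //; case: j LN {E js}.
Qed.

(** The supports of the blocks followed by an infinite remainder form the required set; regularity
    gives back the blocks. *)
Lemma chain_realize N n ps : infsub N N0 -> chain N n ps ->
  exists2 L, infsub L (above N n) &
    forall j, (j < size ps)%N -> consecutive F L j = nth 0 ps j.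
Proof.
move=> NN0; elim: ps n => [|p ps IH] n /=.
  move=> _; exists (above N n) => //; apply/infsub_refl/unbounded_above.
  by case: NN0.
move=> [[L0 L0N pE] /IH[L' L'N L'P]].
have L0N0 : infsub L0 N0 by apply: infsub_trans L0N _; exact: infsub_above0.
have [[_ sp gp] _ loc] := F_reg L0N0; rewrite -pE in sp gp loc.
pose L := [set x | supp p x \/ L' x].
have np : (n < size p)%N.
  by rewrite pE; apply: (reg_size_ge F_reg) => // x /L0N.1[].
have LN : infsub L (above N n).
  split; last by apply: unbounded_sub L'N.2 => x; right.
  move=> x [/sp/L0N.1//|/L'N.1[Nx px]]; split=> //.
  exact: leq_trans (ltnW np) px.
have LN0 : infsub L N0 by apply: infsub_trans LN _; exact: infsub_above0.
have FL : F L = p.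
  apply: loc => // x xp; split=> [L0x|[/sp//|/L'N.1[_]]]; first by left; exact: gp.
  by rewrite leqNgt xp.
have LE : above L (size p) = L'.
  apply/seteqP; split=> x; first by move=> [[/supp_ltn|//]]; rewrite ltnNge => /negbTE->.
  by move=> L'x; split; [right|have [] := L'N.1 _ L'x].
exists L => // -[_|j js]; first by rewrite consecutive0 FL.
by rewrite (consecutiveS F_reg)// FL LE L'P.
Qed.

(** By regularity a block is determined by its support. Coding chains by supports shows that there
    are only countably many, although the coefficients range over an uncountable field. *)
Definition supp_code (p : {poly S}) : seq nat := [seq i <- iota 0 (size p) | p`_i != 0].

Lemma supp_codeP p q : supp_code p = supp_code q -> forall i, (p`_i != 0) = (q`_i != 0).
Proof.
move=> pq i.
have mem (r : {poly S}) : (i \in supp_code r) = (r`_i != 0).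
  rewrite mem_filter mem_iota /= add0n; apply: andb_idr => ri; exact: supp_ltn.
by rewrite -!mem pq.
Qed.

Lemma chain_code_inj N n ps qs : infsub N N0 -> chain N n ps -> chain N n qs ->
  map supp_code ps = map supp_code qs -> ps = qs.
Proof.
move=> NN0; elim: ps qs n => [|p ps IH] [|q qs] n //= chp chq [pq psqs].
have [[L LN pE] chp'] := chp; have [[L' L'N qE] chq'] := chq.
have sub0 T : infsub T (above N n) -> infsub T N0.
  by move=> TN; apply: infsub_trans TN _; exact: infsub_above0.
have pqE := supp_codeP pq.
have szE : size p = size q.
  apply/eqP; rewrite eqn_leq; apply/andP; split; apply/leq_sizeP => i si; apply/eqP.
    by rewrite -[_ == _]negbK pqE negbK nth_default.
  by rewrite -[_ == _]negbK -pqE negbK nth_default.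
have pqe : p = q.
  have [[_ sp gp] _ loc] := F_reg (sub0 _ LN).
  have [[_ sq gq] _ _] := F_reg (sub0 _ L'N).
  rewrite -pE in sp gp loc; rewrite -qE in sq gq.
  rewrite qE; apply/esym/loc; first exact: sub0.
  move=> x xp; split=> [Lx|L'x].
    by apply: sq; rewrite /supp /= -pqE; exact: gp.
  by apply: sp; rewrite /supp /= pqE; apply: gq => //; rewrite -szE.
by rewrite pqe in chp' *; congr cons; exact: IH chp' chq' psqs.
Qed.

End Chains.

(** * Lower estimates along a decomposition into blocks *)

Section Decomposition.
Context {R : realType} {k : scalar_kind} {K : metricType R}.
Context {cK : compact [set: K]}.
Local Notation S := (scalars R k).
Variable f : nat -> CK k cK.
Implicit Types (p q : {poly S}) (vs ws : seq {poly S}).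

Definition psum b t vs : R := \sum_(v <- vs) part b (ev f v t).

Definition aligned b t vs := forall v, v \in vs -> 0 <= part b (ev f v t).

Lemma psum_ge0 b t vs : aligned b t vs -> 0 <= psum b t vs.
Proof.
by move=> al; rewrite /psum big_seq; apply: sumr_ge0 => v; exact: al.
Qed.

Lemma psum_cat b t vs ws : psum b t (vs ++ ws) = psum b t vs + psum b t ws.
Proof. exact: big_cat. Qed.

Lemma aligned_cat b t vs ws : aligned b t (vs ++ ws) -> aligned b t vs /\ aligned b t ws.
Proof. by move=> al; split=> v vv; apply: al; rewrite mem_cat vv ?orbT. Qed.

(* This expresses that p is, up to an error e, a combination of the blocks vs with
   coefficients at least al, in the only form in which it is needed: initial parts
   of p dominate initial sums of vs at the points where no cancellation occurs. *)
Definition dec (al e : R) p vs :=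
  (forall vs1 vs2, vs = vs1 ++ vs2 -> exists r, forall t b, aligned b t vs1 ->
     al * psum b t vs1 - e <= part b (ev f (take_poly r p) t)) /\
  (forall t b, aligned b t vs -> al * psum b t vs - e <= part b (ev f p t)).

Lemma dec_nil al e p : (forall t, av (ev f p t) <= e) -> 0 <= e -> dec al e p [::].
Proof.
move=> pe e0; split=> [[|//] _ _|t b _]; last first.
  rewrite /psum big_nil mulr0 sub0r lerNl (le_trans _ (pe t))// lerNl.
  exact: part_ge.
by exists 0%N => t b _; rewrite take_poly0l ev0 part0 /psum big_nil mulr0 sub0r oppr_le0.
Qed.

Lemma dec_single v : dec 1 0 v [:: v].
Proof.
split=> [[|w [|//]] vs2|t b _]; last by rewrite /psum big_seq1 mul1r subr0.
  by exists 0%N => t b _; rewrite take_poly0l ev0 part0 /psum big_nil mulr0 subr0.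
move=> [-> _]; exists (size w) => t b _.
by rewrite take_poly_id// /psum big_seq1 mul1r subr0.
Qed.

Lemma dec_weaken al e al' e' p vs : al' <= al -> e <= e' -> dec al e p vs ->
  dec al' e' p vs.
Proof.
move=> la le [d1 d2]; split=> [vs1 vs2 /d1[r rP]|t b alg].
  exists r => t b alg; apply: le_trans (rP t b alg); apply: lerB => //.
  by rewrite ler_wpM2r// psum_ge0.
apply: le_trans (d2 t b alg); apply: lerB => //.
by rewrite ler_wpM2r// psum_ge0.
Qed.

Lemma cat_eq_cases (T : Type) (a b c d : seq T) : a ++ b = c ++ d ->
  (exists l, a = c ++ l /\ d = l ++ b) \/ (exists l, c = a ++ l /\ b = l ++ d).
Proof.
elim: a c => [|x a IH] [|y c] /=.
- by move=> ->; left; exists [::].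
- by move=> ->; right; exists (y :: c).
- by move=> <-; left; exists (x :: a).
- move=> [-> /IH[[l [-> ->]]|[l [-> ->]]]]; [left|right]; by exists l.
Qed.

(** The truncation required for an initial part of [vs ++ ws] is taken inside [p] or beyond [p],
    according to where that part ends. *)
Lemma dec_cat al e e' p q vs ws : 0 <= e' -> (forall i, (i < size p)%N -> q`_i = 0) ->
  dec al e p vs -> dec al e' q ws -> dec al (e + e') (p + q) (vs ++ ws).
Proof.
move=> e'0 pq [p1 p2] [q1 q2]; split=> [vs1 vs2 E|t b].
  have [[l [vsE _]]|[l [vs1E wsE]]] := cat_eq_cases E.
    have [r rP] := p1 _ _ vsE; exists (minn r (size p)) => t b alg.
    have -> : take_poly (minn r (size p)) (p + q) = take_poly r p.
      apply/polyP => i; rewrite !coef_take_poly leq_min coefD.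
      case: (ltnP i (size p)) => ip; first by rewrite pq// addr0 andbT.
      by rewrite andbF nth_default//; case: ifP.
    apply: le_trans (rP t b alg); lra.
  have [r rP] := q1 _ _ wsE; exists (maxn r (size p)) => t b.
  rewrite vs1E => /aligned_cat[algv algl]; rewrite psum_cat.
  have -> : take_poly (maxn r (size p)) (p + q) = p + take_poly r q.
    apply/polyP => i; rewrite coefD !coef_take_poly leq_max coefD.
    case: (ltnP i (size p)) => ip; first by rewrite orbT pq//; case: ifP.
    by rewrite orbF nth_default// !add0r.
  have := p2 t b algv; have := rP t b algl; rewrite evD partD mulrDr; lra.
move=> /aligned_cat[algv algw]; rewrite psum_cat.
have := p2 t b algv; have := q2 t b algw; rewrite evD partD mulrDr; lra.
Qed.

Lemma dec_unitize al e p vs : 0 < nrm f p -> dec al e p vs ->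
  dec (al / nrm f p) (e / nrm f p) (unitize f p) vs.
Proof.
move=> n0 [p1 p2]; split=> [vs1 vs2 /p1[r rP]|t b alg].
  exists r => t b alg.
  rewrite unitizeE take_polyZ evZ partM ?emb_inv_ge0 ?nrm_ge0//.
  rewrite re_emb_inv ?nrm_ge0// mulrAC -mulrBl mulrC ler_wpM2l ?invr_ge0 ?nrm_ge0//.
  exact: rP.
rewrite part_ev_unitize mulrAC -mulrBl ler_wpM2r ?invr_ge0 ?nrm_ge0//.
exact: p2.
Qed.

End Decomposition.

(** * Averages whose sums do not grow *)

Section Stable.
Context {R : realType} {k : scalar_kind} {K : metricType R}.
Context {cK : compact [set: K]}.
Local Notation S := (scalars R k).
Variables (s : omega1 -> nat -> omega1) (f : nat -> CK k cK) (N0 : set nat).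
Hypothesis hs : associated_sequences s.
Hypothesis f_norm : normalized_seq f.
Hypothesis coef_le :
  forall p : {poly S}, supp p `<=` N0 -> forall i, av p`_i <= 4 * nrm f p.
Hypothesis take_le2 : forall p : {poly S}, supp p `<=` N0 -> forall j,
  nrm f (take_poly j p) <= 2 * nrm f p.
Hypothesis take_le1 : forall d : R, 0 < d -> exists n0, forall p : {poly S},
  supp p `<=` N0 -> (forall i, (i < n0)%N -> p`_i = 0) -> forall j,
  nrm f (take_poly j p) <= (1 + d) * nrm f p.

Local Notation A := (first s f).
Let reg a : regular f N0 (A a) := regular_first hs f_norm coef_le a.

Definition stable (eta : R) a N := forall b, (a <= b)%O ->
  dense_in N (fun L => growth s f b L <= 1 + eta).

Lemma stable_upward eta : upward (stable eta).
Proof.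
move=> a a' N N' st aa' N'N b a'b; apply: dense_in_almost N'N _.
by apply: st; exact: le_trans a'b.
Qed.

Lemma growth_local b L : infsub L N0 -> exists n, forall L', infsub L' N0 ->
  (forall x, (x < n)%N -> L x <-> L' x) -> growth s f b L' = growth s f b L.
Proof.
move=> LN; pose q := bsum (A b) L (minelt L).+1.
have cq : covers L q by exact: (covers_bsum (reg b)).
have q0 : q != 0 by exact: (bsum_neq0 (reg b)).
have [Lm mL] := mineltP LN.2.
have [ms _] := covers_min cq LN.2 q0.
exists (size q) => L' L'N LL'.
have mE : minelt L' = minelt L.
  apply: minelt_eq; first exact/LL'.
  move=> l L'l; rewrite leqNgt; apply/negP => lm.
  by have /(LL' _ (ltn_trans lm ms))/mL := L'l; rewrite leqNgt lm.
rewrite /growth mE; congr (nrm f _); apply: eq_bigr => i _.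
apply: (@consecutive_local _ _ _ _ _ _ _ (reg b) L L' (minelt L).+1 (size q)) => // j jm.
exact: (size_bsum_ge (reg b)).
Qed.

(** Growth at least [1 + eta] is an open condition on [L], hence Ramsey. Where stability fails, the
    homogeneous sets must be of the growing kind, and cofinally many of them are excluded by
    assumption. *)
Lemma stable_cofinal a0 N00 eta : infsub N00 N0 ->
  (forall a N, infsub N N0 -> ~ cofinal a N
     (fun b N' => forall L, infsub L N' -> 1 + eta <= growth s f b L)) ->
  cofinal a0 N00 (stable eta).
Proof.
move=> N00N0 ng a N a0a NN00; have NN0 := infsub_trans NN00 N00N0.
apply: contrapT => nst; apply: (ng a N NN0) => b N1 ab N1N.
apply: contrapT => nb; apply: nst; exists b, N1; split=> // c bc N2 N2N1.
have N2N0 : infsub N2 N0 by exact: infsub_trans N2N1 (infsub_trans N1N NN0).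
have [|N3 N3N2 [all_in|all_out]] := @open_Ramsey (fun L => 1 + eta <= growth s f c L) N2 N2N0.2.
- move=> L LN2 gL; have [n nP] := growth_local c (infsub_trans LN2 N2N0).
  by exists n => L' L'N2 LL'; rewrite nP//; exact: infsub_trans N2N0.
- case: nb; exists c, N3; split=> //; exact: infsub_trans N2N1.
- by exists N3 => // L /all_out/negP; rewrite -ltNge => /ltW.
Qed.

Variables (a1 : omega1) (N1 : set nat).
Hypothesis N1N0 : infsub N1 N0.
Hypothesis st : forall eta, 0 < eta -> stable eta a1 N1.

Local Notation F := (A a1).

Definition heavy (vs : seq {poly S}) := exists vs1 vs2, vs = vs1 ++ vs2 /\
  exists t b, aligned f b t vs1 /\ 8%:R < psum f b t vs1.

Lemma heavy_cat vs ws : heavy vs -> heavy (vs ++ ws).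
Proof. by move=> [vs1 [vs2 [-> hv]]]; exists vs1, (vs2 ++ ws); rewrite catA. Qed.

(** * Averages of larger ordinals as near combinations of [a1]-averages *)

Section Dec.
Variable N2 : set nat.
Hypothesis N2N1 : infsub N2 N1.
Let N2N0 : infsub N2 N0 := infsub_trans N2N1 N1N0.

(** Only one suitable average inside each infinite subset of [N2] is asked for; [d] bounds both the
    loss in the coefficients and the error. *)
Definition decomposable a (P : seq {poly S} -> Prop) := forall (d : R) N,
  0 < d -> d <= 1 -> infsub N N2 -> exists L vs,
  [/\ infsub L N, chain F N 0 vs, dec f (1 - d) d (A a L) vs & P vs].

Lemma decomposable_imp a P Q : (forall vs, P vs -> Q vs) ->
  decomposable a P -> decomposable a Q.
Proof.
move=> PQ dP d N d0 d1 NN; have [L [vs [? ? ? /PQ Q']]] := dP d N d0 d1 NN.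
by exists L, vs.
Qed.

Lemma decomposable_first : decomposable a1 (fun vs => vs != [::]).
Proof.
move=> d N d0 d1 NN; exists N, [:: F N]; split=> //.
- exact: infsub_refl NN.2.
- by split=> //; exists N => //; split; [move=> x Nx|case: NN].
- by apply: dec_weaken (dec_single f _); lra.
Qed.

Lemma sub_first N a L : infsub N N0 -> infsub L N -> supp (A a L) `<=` N.
Proof.
move=> NN0 LN; have [[_ sL _] _ _] := reg a (infsub_trans LN NN0).
by move=> x /sL/LN.1.
Qed.

Lemma decomposable_many a : decomposable a (fun=> True) ->
  forall r (d : R) N, 0 < d -> d <= 1 -> infsub N N2 -> exists ps vs,
  [/\ size ps = r, chain (A a) N 0 ps, chain F N 0 vs &
      dec f (1 - d) (r%:R * d) (\sum_(p <- ps) p) vs].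
Proof.
move=> da; elim=> [|r IH] d N d0 d1 NN.
  exists [::], [::]; split=> //; rewrite big_nil mul0r; apply: dec_nil => // t.
  by rewrite ev0 av0.
have [L [vs [LN chv dv _]]] := da d N d0 d1 NN.
pose z := maxn (size (A a L)) (chain_end 0 vs).
have aN : infsub (above N z) N by apply: infsub_above; case: NN.
have aN2 := infsub_trans aN NN; have aN0 := infsub_trans aN2 N2N0.
have [ps [ws [sz chp chw dw]]] := IH d _ d0 d1 aN2.
exists (A a L :: ps), (vs ++ ws); split.
- by rewrite /= sz.
- split; first by exists L => //; split; [move=> x /LN.1|case: LN].
  by apply: chain_le (chain_above chp); exact: leq_maxl.
- apply/chain_cat; split=> //.
  by apply: chain_le (chain_above chw); exact: leq_maxr.
- have -> : r.+1%:R * d = d + r%:R * d by rewrite -natr1 mulrDl mul1r addrC.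
  rewrite big_cons; apply: dec_cat => //.
    by rewrite mulr_ge0// ltW.
  move=> i iz; apply: (chain_supp (reg a) aN0 chp) => -[_].
  by rewrite leqNgt (leq_trans iz)// leq_maxl.
Qed.

Lemma minelt_first a L L' : infsub L N0 -> infsub L' N0 -> A a L = A a L' ->
  minelt L = minelt L'.
Proof.
move=> LN L'N LL'.
have [cL _ _] := reg a LN; have [cL' _ _] := reg a L'N.
have [_ mL] := covers_min cL LN.2 (reg_neq0 (reg a) LN).
have [_ mL'] := covers_min cL' L'N.2 (reg_neq0 (reg a) L'N).
have [_ sL _] := cL; have [_ sL' _] := cL'.
apply/eqP; rewrite eqn_leq; apply/andP; split.
  by apply: (mineltP LN.2).2; apply: sL; rewrite /supp /= LL'.
by apply: (mineltP L'N.2).2; apply: sL'; rewrite /supp /= -LL'.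
Qed.

(** The first [a]-average fixes the number of summands. The second is chosen afterwards, so that its
    blocks may depend on those of the first; the remaining ones are arbitrary. *)
Lemma decomposable_succ a P (Q : seq {poly S} -> seq {poly S} -> Prop) :
  (a1 <= a)%O -> decomposable a P ->
  (forall vs, chain F N2 0 vs -> P vs -> decomposable a (Q vs)) ->
  decomposable (osucc a) (fun vs => exists vs0 vs1 ws,
    [/\ vs = vs0 ++ vs1 ++ ws, P vs0 & Q vs0 vs1]).
Proof.
move=> a1a dP dQ d N d0 d1 NN2.
have d40 : 0 < d / 4%:R by rewrite divr_gt0.
have NN0 := infsub_trans NN2 N2N0.
have [N3 N3N gr] := st d40 a1a (infsub_trans NN2 N2N1).
have [g gP] := growth_ge hs f_norm coef_le take_le1 (@ltr01 R).
(* The bound 1 guarantees at least two summands, the bound [g] a growth of at least 1/2. *)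
pose N4 := above N3 (maxn 1 g).
have N4N : infsub N4 N by exact: infsub_trans (infsub_above _ N3N.2) N3N.
have N4N2 := infsub_trans N4N NN2; have N4N0 := infsub_trans N4N NN0.
have d80 : 0 < d / 8%:R by rewrite divr_gt0.
have d81 : d / 8%:R <= 1 by lra.
have [L0 [vs0 [L0N ch0 dec0 P0]]] := dP _ N4 d80 d81 N4N2.
have L0N0 := infsub_trans L0N N4N0.
pose m := minelt L0; have [L0m m_min] := mineltP L0N.2.
have m0 : (0 < m)%N by have [_] := L0N.1 _ L0m; rewrite geq_max => /andP[].
(* The [m] averages after the first share a total error of $d/8$. *)
pose e := d / 8%:R / m%:R.
have m1 : 1 <= m%:R :> R by rewrite ler1n.
have e0 : 0 < e by rewrite divr_gt0// (lt_le_trans ltr01).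
have ed : e <= d / 8%:R by rewrite ler_pdivrMr ?(lt_le_trans ltr01)// ler_peMr// ltW.
have e1 : e <= 1 by exact: le_trans d81.
pose z0 := maxn (size (A a L0)) (chain_end 0 vs0).
pose N5 := above N4 z0.
have N5N4 : infsub N5 N4 by apply: infsub_above; case: N4N.
have N5N2 := infsub_trans N5N4 N4N2; have N5N0 := infsub_trans N5N4 N4N0.
have [L1 [vs1 [L1N ch1 dec1 Q1]]] :=
  dQ vs0 (chain_sub N4N2.1 ch0) P0 e N5 e0 e1 N5N2.
have L1N0 := infsub_trans L1N N5N0.
pose z1 := maxn (size (A a L1)) (chain_end 0 vs1).
pose N6 := above N5 z1.
have N6N5 : infsub N6 N5 by apply: infsub_above; case: N5N4.
have N6N2 := infsub_trans N6N5 N5N2; have N6N0 := infsub_trans N6N5 N5N0.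
have [ps [ws [sz chp chw decw]]] :=
  decomposable_many (decomposable_imp (fun _ _ => I) dP) m.-1 e0 e1 N6N2.
have chA : chain (A a) N4 0 (A a L0 :: A a L1 :: ps).
  split; first by exists L0 => //; split; [move=> x /L0N.1|case: L0N].
  split.
    exists L1 => //; split; last by case: L1N.
    by move=> x /L1N.1[N4x zx]; split=> //; apply: leq_trans zx; exact: leq_maxl.
  apply: (chain_sub N5N4.1); apply: chain_le (chain_above chp); exact: leq_maxl.
have chF : chain F N4 0 (vs0 ++ vs1 ++ ws).
  apply/chain_cat; split=> //.
  apply: (chain_le (leq_maxr (size (A a L0)) _)).
  apply: (chain_above (n := 0%N)); apply/chain_cat; split=> //.
  by apply: chain_le (chain_above chw); exact: leq_maxr.
have [L LN LP] := chain_realize (reg a) N4N0 chA.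
have LN4 : infsub L N4 by split; [move=> x /LN.1[]|case: LN].
have LN0 := infsub_trans LN4 N4N0.
have LL0 : A a L = A a L0 by have := LP 0%N isT.
have mE : minelt L = m by exact: minelt_first LL0.
have qE : bsum (A a) L (minelt L).+1 = A a L0 + (A a L1 + \sum_(p <- ps) p).
  have sE : size (A a L0 :: A a L1 :: ps) = (minelt L).+1.
    by rewrite /= sz mE prednK.
  have -> : A a L0 + (A a L1 + \sum_(p <- ps) p) = \sum_(p <- A a L0 :: A a L1 :: ps) p.
    by rewrite !big_cons.
  rewrite (big_nth 0) sE big_mkord; apply: eq_bigr => i _.
  by apply: LP; rewrite sE ltn_ord.
have decq : dec f (1 - d / 8%:R) (d / 4%:R) (bsum (A a) L (minelt L).+1) (vs0 ++ vs1 ++ ws).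
  rewrite qE; have -> : d / 4%:R = d / 8%:R + (e + m.-1%:R * e).
    have mp : m%:R = m.-1%:R + 1 :> R by rewrite natr1 prednK.
    have : m%:R * e = d / 8%:R.
      by rewrite /e mulrC divfK// gt_eqF// (lt_le_trans ltr01).
    rewrite mp mulrDl mul1r; lra.
  apply: dec_cat => //; first by rewrite addr_ge0 ?mulr_ge0// ltW.
    move=> i iz; rewrite coefD.
    have ni : ~ N5 i by move=> [_]; rewrite leqNgt (leq_trans iz)// leq_maxl.
    rewrite (chain_supp (reg a) N6N0 chp) ?addr0; last by move=> /N6N5.1.
    by apply/eqP; apply: contraT => /(sub_first N5N0 L1N)/ni.
  apply: dec_cat => //; first by rewrite mulr_ge0// ltW.
  - move=> i iz; apply: (chain_supp (reg a) N6N0 chp) => -[_].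
    by rewrite leqNgt (leq_trans iz)// leq_maxl.
  - by apply: dec_weaken dec1; lra.
  - by apply: dec_weaken decw; lra.
have gL : growth s f a L <= 1 + d / 4%:R.
  by apply: gr; apply: infsub_trans LN4 (infsub_above _ N3N.2).
have gL2 : 1 <= 2%:R * growth s f a L.
  have -> : 2%:R = 1 + 1 :> R by ring.
  by apply: gP => // x /LN4.1[_]; rewrite geq_max => /andP[].
have g0 : 0 < growth s f a L by lra.
exists L, (vs0 ++ vs1 ++ ws); split=> //.
- exact: infsub_trans N4N.
- exact: chain_sub N4N.1 chF.
(* Growth lies between 1/2 and $1+d/4$: the coefficients stay above $(1-d/8)/(1+d/4)\ge 1-d$, and
   the error is at most $d/2$. *)
- rewrite (first_succ hs f_norm a LN0); apply: dec_weaken (dec_unitize g0 decq).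
    rewrite ler_pdivlMr//; apply: (@le_trans _ _ ((1 - d) * (1 + d / 4%:R))).
      by rewrite ler_wpM2l//; lra.
    nra.
  rewrite ler_pdivrMr// -/(growth s f a L); nra.
- by exists vs0, vs1, ws.
Qed.

(** The extra term of a limit average, with coefficient $1/(m+1)$, counts as an error; the block of
    ordinal [s a m] supplies the decomposition. *)
Lemma decomposable_limit a P n0 : is_limit a ->
  (forall n, (n0 <= n)%N -> decomposable (s a n) P) -> decomposable a P.
Proof.
move=> al dP d N d0 d1 NN2; have NN0 := infsub_trans NN2 N2N0.
have d80 : 0 < d / 8%:R by rewrite divr_gt0.
have d81 : d / 8%:R <= 1 by lra.
have [g gP] := natSinv_le d80.
have [m] := NN2.2 (maxn 1 (maxn n0 g)); rewrite !geq_max => /and3P[m1 n0m gm] Nm.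
have aN : infsub (above N m.+1) N by apply: infsub_above; case: NN2.
have [L1 [vs [L1N ch dv Pv]]] := dP m n0m _ (above N m.+1) d80 d81 (infsub_trans aN NN2).
pose L := [set x | x = m \/ L1 x].
have LN : infsub L N.
  split; first by move=> x [->//|/L1N.1/aN.1].
  by apply: unbounded_sub L1N.2 => x; right.
have LN0 := infsub_trans LN NN0.
have mE : minelt L = m.
  apply: minelt_eq; first by left.
  by move=> x [->//|/L1N.1[_ /ltnW]].
have LE : above L m.+1 = L1.
  apply/seteqP; split=> x; first by move=> [[->|//]]; rewrite ltnn.
  by move=> L1x; split; [right|have [] := L1N.1 _ L1x].
have L1N0 : infsub L1 N0 by exact: infsub_trans L1N (infsub_trans aN NN0).
have m0L : (0 < minelt L)%N by rewrite mE.
exists L, vs; split=> //; first exact: chain_sub aN.1 ch.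
rewrite (first_limit f hs al LN0 m0L) mE LE; set q := A _ L1; set x := m.+1%:R^-1 *: 'X^m.
have rm := gP m gm; set y := m.+1%:R^-1 in rm.
have y0 : 0 <= y by rewrite invr_ge0.
have avm : av (m.+1%:R^-1 : S) = y by rewrite avV av_natr.
have nx : nrm f x = y by rewrite /x nrmZ (nrmX f_norm) mulr1 avm.
have q1 : nrm f q = 1 by rewrite (first_nrm hs f_norm coef_le).
have up : nrm f (x + q) <= 1 + d / 8%:R.
  by rewrite (le_trans (nrmD _ _ _))// nx q1 addrC lerD2l.
have lo : 1 - d / 8%:R <= nrm f (x + q).
  have := nrmD f (x + q) (- x); rewrite addrAC subrr add0r q1 nrmN nx => le1.
  by rewrite lerBlDr (le_trans le1)// lerD2l.
have g0 : 0 < nrm f (x + q) by lra.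
have decq : dec f (1 - d / 8%:R) (d / 8%:R + d / 8%:R) (x + q) ([::] ++ vs).
  apply: dec_cat => //; first exact: ltW.
    move=> i; have -> : size x = m.+1.
      by rewrite /x size_scale ?size_polyXn// invr_eq0 pnatr_eq0.
    move=> im; apply/eqP; apply: contraT.
    by move=> /(sub_first (infsub_trans aN NN0) L1N)[_]; rewrite leqNgt im.
  apply: dec_nil; last exact: ltW.
  by move=> t; rewrite (le_trans (nrm_ub _ _ _))// nx.
apply: dec_weaken (dec_unitize g0 decq).
  rewrite ler_pdivlMr//; apply: (@le_trans _ _ ((1 - d) * (1 + d / 8%:R))).
    by rewrite ler_wpM2l//; lra.
  nra.
rewrite ler_pdivrMr//; nra.
Qed.

(** At a successor the first summand provides [P], and the blocks of the others are only
    appended. *)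
Lemma decomposable_persist a P : (a1 <= a)%O ->
  (forall vs ws, P vs -> P (vs ++ ws)) -> decomposable a P ->
  forall b, (a <= b)%O -> decomposable b P.
Proof.
move=> a1a Pext dP b; elim/omega1_ind: b => b IH.
rewrite le_eqVlt => /predU1P[<-//|ab].
have [b0|[c bE]|bl] := omega1_cases b.
- by have := b0 a; rewrite leNgt ab.
- have ac : (a <= c)%O by rewrite -lt_osucc_le -bE.
  have dc : decomposable c P by apply: IH => //; rewrite bE lt_osucc.
  rewrite bE; apply: decomposable_imp (decomposable_succ (Q := fun _ _ => True)
    (le_trans a1a ac) dc _); last by move=> vs _ _; exact: decomposable_imp dc.
  by move=> _ [vs0 [vs1 [ws [-> P0 _]]]]; exact: Pext.
- have [n0 n0P] := limit_cofinal hs bl ab.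
  apply: (decomposable_limit (n0 := n0) bl) => n nn.
  exact: IH (limit_lt n hs bl) (n0P n nn).
Qed.

(** The ordinal [a] acts as a bound for the rank of [us] in the tree of chains that are not
    heavy. *)
Definition eventually_heavy us := exists2 a, (a1 <= a)%O & forall b, (a <= b)%O ->
  decomposable b (fun vs => heavy (us ++ vs)).

Lemma eventually_heavy_heavy us : heavy us -> eventually_heavy us.
Proof.
move=> hu; exists a1 => // b a1b.
apply: (@decomposable_imp _ (fun vs => vs != [::])).
  by move=> vs _; exact: heavy_cat.
apply: decomposable_persist decomposable_first _ a1b => //.
by case.
Qed.

(** Let [a] bound the ordinals of all extensions of [us]. In an [osucc a]-average the first summand
    supplies an extension [vs] of [us], and the second, chosen with knowledge of [vs], makes it
    heavy. *)
Lemma eventually_heavy_step us : chain F N2 0 us ->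
  (forall vs, vs != [::] -> chain F N2 0 (us ++ vs) -> eventually_heavy (us ++ vs)) ->
  eventually_heavy us.
Proof.
move=> chu ev_h; pose z := chain_end 0 us.
(* The ordinals are indexed by codes, a countable type, so that they have a supremum. *)
have /choice[w wP] (c : seq (seq nat)) : exists a, forall vs, vs != [::] ->
    chain F N2 0 (us ++ vs) -> map supp_code vs = c -> forall b, (a <= b)%O ->
    decomposable b (fun ws => heavy ((us ++ vs) ++ ws)).
  have [[vs [v0 chv cE]]|nv] := pselect (exists vs, [/\ vs != [::],
      chain F N2 0 (us ++ vs) & map supp_code vs = c]); last first.
    by exists a1 => vs v0 chv cE; case: nv; exists vs.
  have [a a1a aP] := ev_h vs v0 chv; exists a => vs' v'0 chv' cE'.
  suff -> : vs' = vs by [].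
  have [_ ch] := (chain_cat _ _ _ _ _).1 chv.
  have [_ ch'] := (chain_cat _ _ _ _ _).1 chv'.
  by apply: (chain_code_inj (reg a1) N2N0 ch' ch); rewrite cE cE'.
have [a a1a aP] := omega1_sup_countable w a1.
have dne b : (a1 <= b)%O -> decomposable b (fun vs => vs != [::]).
  by move=> a1b; apply: decomposable_persist decomposable_first _ a1b => // -[].
have dP : decomposable a (fun vs => vs != [::] /\ chain F N2 0 (us ++ vs)).
  move=> d N d0 d1 NN2.
  have aN : infsub (above N z) N by apply: infsub_above; case: NN2.
  have [L [vs [LN ch dv v0]]] := dne a a1a d _ d0 d1 (infsub_trans aN NN2).
  exists L, vs; split=> //; first exact: infsub_trans aN.
    exact: chain_sub aN.1 ch.
  split=> //; apply/chain_cat; split=> //.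
  exact: chain_sub NN2.1 (chain_above ch).
have dS : decomposable (osucc a) (fun vs => heavy (us ++ vs)).
  apply: decomposable_imp (decomposable_succ
    (Q := fun vs ws => heavy ((us ++ vs) ++ ws)) a1a dP _).
    move=> _ [vs0 [vs1 [ws [-> _ hv]]]]; rewrite !catA; exact: heavy_cat.
  move=> vs _ [v0 chv]; exact: wP v0 chv erefl a (aP _).
exists (osucc a); first exact: le_trans a1a (le_osucc _).
apply: decomposable_persist dS.
  exact: le_trans a1a (le_osucc _).
by move=> vs ws hv; rewrite catA; exact: heavy_cat.
Qed.

(** If the empty chain is not eventually heavy, the step lemma yields an infinite branch of such
    chains; the set glued from it would have a heavy initial segment. If it is, some average is too
    large. *)
Lemma not_all_heavy :
  ~ (forall L, infsub L N2 -> exists m, heavy (mkseq (consecutive F L) m)).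
Proof.
move=> allH.
have [a a1a aP] : eventually_heavy [::].
  apply: contrapT => nE.
  have [] := @dependent_choice_in (seq {poly S})
    (fun n us => [/\ ~ eventually_heavy us, chain F N2 0 us & (n <= size us)%N])
    (fun _ us us' => exists vs, us' = us ++ vs) [::].
  - by split.
  - move=> n us [nu chu nsz]; apply: contrapT => nn; apply: nu.
    apply: eventually_heavy_step => // vs v0 chv; apply: contrapT => nv; apply: nn.
    exists (us ++ vs); split; last by exists vs.
    split=> //; rewrite size_cat -addn1 leq_add//.
    by case: vs v0 {chv nv}.
  move=> u [_ uP].
  have pre i j : (i <= j)%N -> exists vs, u j = u i ++ vs.
    move=> /subnK <-; elim: (j - i)%N => [|d [vs E]]; first by exists [::]; rewrite cats0.
    have [_ [ws]] := uP (d + i)%N; rewrite addSn => ->.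
    by exists (vs ++ ws); rewrite E catA.
  have sz i : (i <= size (u i))%N by have [[]] := uP i.
  pose v j := nth 0 (u j.+1) j.
  have vE i j : (j < i)%N -> v j = nth 0 (u i) j.
    by move=> ji; have [vs ->] := pre _ _ ji; rewrite nth_cat sz.
  have [|L LN LP] := glue_blocks (reg a1) (N := N2) (n := 0%N) (v := v) N2N0.
    move=> j; have [[_ ch _] _] := uP j.+1.
    have [L LN E] := chain_nth ch (sz j.+1); exists L => //.
    by case: j LN {E} ch => // j LN ch; rewrite (vE j.+2)//; exact: leqW.
  have LN2 : infsub L N2 by split; [move=> x /LN.1[]|case: LN].
  have [m hm] := allH L LN2; have [[nE' _ _] _] := uP m; apply: nE'.
  apply: eventually_heavy_heavy.
  have {hm} : heavy (take m (u m)).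
    suff <- : mkseq (consecutive F L) m = take m (u m) by [].
    apply: (@eq_from_nth _ 0); rewrite size_mkseq ?size_takel ?sz// => i im.
    by rewrite nth_mkseq// LP nth_take// (vE m).
  by move=> /(heavy_cat (drop m (u m))); rewrite cat_take_drop.
(* With coefficients at least 1/2 and error 1/2, a heavy segment gives an initial projection of norm
   above $8/2-1/2$, whereas [take_le2] bounds it by 2. *)
have half0 : 0 < 2%:R^-1 :> R by rewrite invr_gt0.
have half1 : 2%:R^-1 <= 1 :> R by lra.
have [L [vs [LN ch [dv _] /= hv]]] := aP a (lexx _) _ N2 half0 half1 (infsub_refl N2N1.2).
have [vs1 [vs2 [vsE [t [b [alg hp]]]]]] := hv.
have [r rP] := dv _ _ vsE; have := rP t b alg.
have LN0 : infsub L N0 by exact: infsub_trans LN N2N0.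
have := take_le2 (subset_trans (sub_first (a := a) N2N0 LN) N2N0.1) r; rewrite (first_nrm hs f_norm coef_le)//.
have := nrm_ub f (take_poly r (A a L)) t; have := part_le b (ev f (take_poly r (A a L)) t).
lra.
Qed.

End Dec.

Lemma heavy_open L : infsub L N0 -> (exists m, heavy (mkseq (consecutive F L) m)) ->
  exists n, forall L', infsub L' N0 -> (forall x, (x < n)%N -> L x <-> L' x) ->
    exists m, heavy (mkseq (consecutive F L') m).
Proof.
move=> LN [m hm]; exists (size (bsum F L m)) => L' L'N LL'; exists m.
suff -> : mkseq (consecutive F L') m = mkseq (consecutive F L) m by [].
apply: (@eq_from_nth _ 0); rewrite !size_mkseq// => i im; rewrite !nth_mkseq//.
apply: (@consecutive_local _ _ _ _ _ _ _ (reg a1) L L' m (size (bsum F L m))) => // j jm.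
exact: (size_bsum_ge (reg a1)).
Qed.

(** The Ramsey property leaves a set without heavy sequences. There each of the four parts
    contributes at most 8 to the sum of moduli. *)
Lemma absolutely_bounded : exists2 L, infsub L N1 & forall m t,
  \sum_(j < m) av (ev f (consecutive F L j) t) <= 32%:R.
Proof.
have [|L LN1 [all_in|all_out]] := @open_Ramsey
  (fun L => exists m, heavy (mkseq (consecutive F L) m)) N1 N1N0.2.
- move=> L LN1 hL; have [n nP] := heavy_open (infsub_trans LN1 N1N0) hL.
  by exists n => L' L'N1; apply: nP; exact: infsub_trans N1N0.
- by case: (not_all_heavy LN1 all_in).
exists L => // m t; have LN0 := infsub_trans LN1 N1N0.
(* The blocks whose part [b] is nonnegative at [t] are the first averages of some subset of [L],
   which is not heavy. *)
have bd b : \sum_(j < m) Num.max 0 (part b (ev f (consecutive F L j) t)) <= 8%:R.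
  pose ps := [seq p <- mkseq (consecutive F L) m | 0 <= part b (ev f p t)].
  have -> : \sum_(j < m) Num.max 0 (part b (ev f (consecutive F L j) t)) = psum f b t ps.
    rewrite /psum big_filter big_map -val_enum_ord big_map big_enum_cond /=.
    rewrite [RHS]big_mkcond /=; apply: eq_bigr => j _.
    by case: ifPn => [j0|]; [rewrite max_r|rewrite -ltNge => /ltW j0; rewrite max_l].
  have chp : chain F L 0 ps.
    apply: (chain_filter (reg a1)) => //; apply: (chain_consecutive (reg a1)) => //.
    by split; [move=> x Lx|case: LN0].
  have [L' L'L L'P] := chain_realize (reg a1) LN0 chp.
  rewrite leNgt; apply/negP => gt8.
  case: (all_out L'); first by split; [move=> x /L'L.1[]|case: L'L].
  exists (size ps), ps, [::]; split; last first.
    by exists t, b; split=> // p; rewrite mem_filter => /andP[].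
  rewrite cats0; apply: (@eq_from_nth _ 0); rewrite size_mkseq// => i ip.
  by rewrite nth_mkseq// L'P.
apply: (@le_trans _ _ (\sum_(j < m) \sum_(b : bool * bool)
    Num.max 0 (part b (ev f (consecutive F L j) t)))).
  by apply: ler_sum => j _; exact: av_le_parts.
rewrite exchange_big /=; apply: (@le_trans _ _ (\sum_(b : bool * bool) 8%:R)).
  by apply: ler_sum => b _; exact: bd.
by rewrite sumr_const card_prod card_bool -mulrnA ler_nat.
Qed.

End Stable.

(** * Equivalence with the unit vector basis of c_0 *)

Section C0.
Context {R : realType} {k : scalar_kind} {K : metricType R}.
Context {cK : compact [set: K]}.
Local Notation S := (scalars R k).
Variables (f : nat -> CK k cK) (N0 : set nat) (F : set nat -> {poly S}).
Hypothesis F_reg : regular f N0 F.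
Hypothesis take_le2 : forall p : {poly S}, supp p `<=` N0 -> forall j,
  nrm f (take_poly j p) <= 2 * nrm f p.
Variable L : set nat.
Hypothesis LN0 : infsub L N0.

Local Notation u := (consecutive F L).

Lemma consecutive_lt j : forall x, supp (u j.+1) x -> (size (u j) <= x)%N.
Proof.
move=> x; have [[_ sL _] _ _] := F_reg (tailset_infsub0 F j.+1 LN0).
by move=> /sL; rewrite /= beyondE => -[].
Qed.

Lemma consecutive_neq0 j : u j != 0.
Proof. exact/(reg_neq0 F_reg)/tailset_infsub0. Qed.

Lemma consecutive_supp j : supp (u j) `<=` N0.
Proof.
have T := tailset_infsub0 F j LN0.
by have [[_ sL _] _ _] := F_reg T; move=> x /sL/T.1.
Qed.

Lemma consecutive_size_le i j : (i <= j)%N -> (size (u i) <= size (u j))%N.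
Proof.
move=> /subnK <-; elim: (j - i)%N => // d IH; apply: (leq_trans IH).
rewrite addSn; set p := u (d + i).+1.
have sp : supp p (size p).-1.
  by rewrite /supp /= -lead_coefE lead_coef_eq0 consecutive_neq0.
exact: leq_trans (consecutive_lt sp) (leq_pred _).
Qed.

Lemma block_basis_consecutive : block_basis u.
Proof.
split=> [n|n i j ui uj]; first exact: consecutive_neq0.
exact: leq_trans (supp_ltn ui) (consecutive_lt uj).
Qed.

Definition block_start i := if i is i'.+1 then size (u i') else 0%N.

Lemma block_start_supp i x : supp (u i) x -> (block_start i <= x)%N.
Proof. by case: i => // i; exact: consecutive_lt. Qed.

Lemma size_le_block_start i j : (j < i)%N -> (size (u j) <= block_start i)%N.
Proof. by case: i => //= i; rewrite ltnS; exact: consecutive_size_le. Qed.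

Lemma block_start_le_size i j : (i <= j)%N -> (block_start i <= size (u j))%N.
Proof. by case: i => // i /ltnW; exact: consecutive_size_le. Qed.

(* The i-th term of a combination is cut out by two initial projections. *)
Lemma coef_le_comb n (x : nat -> S) i : (i < n)%N ->
  av (x i) <= 4 * nrm f (\sum_(j < n) x j *: u j).
Proof.
move=> lt_in; set P := \sum_(j < n) _.
pose b := block_start i.
have take_lt j z : (size (u j) <= z)%N -> take_poly z (u j) = u j.
  exact: take_poly_id.
have take_gt j z : (forall y, supp (u j) y -> (z <= y)%N) -> take_poly z (u j) = 0.
  move=> zu; apply/polyP => y; rewrite coef_take_poly coef0; case: ltnP => // yz.
  by apply/eqP; apply: contraT => /zu; rewrite leqNgt yz.
have PE : x i *: u i = take_poly (size (u i)) P - take_poly b P.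
  rewrite !take_poly_sum -sumrB (bigD1 (Ordinal lt_in))//= !take_polyZ take_lt//.
  rewrite take_gt ?scaler0 ?subr0; last exact: block_start_supp.
  rewrite big1 ?addr0// => j; rewrite -val_eqE /= => ji; rewrite !take_polyZ.
  have [lt_ji|] := ltnP j i.
    rewrite !take_lt ?subrr//; first exact: size_le_block_start.
    exact/consecutive_size_le/ltnW.
  rewrite leq_eqVlt eq_sym (negbTE ji) /=; case: (nat_of_ord j) => // j' ij'.
  rewrite !take_gt ?subrr// => y /consecutive_lt; apply: leq_trans.
    exact: block_start_le_size.
  exact: consecutive_size_le.
have PN0 : supp P `<=` N0.
  move=> y; rewrite /supp /= coef_sum => Py; apply: contrapT => Ny.
  move/negP: Py; apply; apply/eqP/big1 => j _; rewrite coefZ.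
  have [->|/consecutive_supp//] := eqVneq (u j)`_y 0; exact: mulr0.
have := nrmD f (take_poly (size (u i)) P) (- take_poly b P).
rewrite -PE nrmZ nrmN; have [_ -> _] := F_reg (tailset_infsub0 F i LN0).
have := take_le2 PN0 (size (u i)); have := take_le2 PN0 b; rewrite mulr1; lra.
Qed.

Lemma embM (x y : R) : emb (x * y) = emb x * emb y :> S.
Proof. by rewrite /emb; case: k => //=; rewrite rmorphM. Qed.

(** The lower constant 1/4 comes from [coef_le_comb]; the upper one from bounding the combination
    pointwise by its largest coefficient times [B]. *)
Lemma equivalent_c0_consecutive (B : R) : 0 < B ->
  (forall m t, \sum_(j < m) av (ev f (u j) t) <= B) ->
  equivalent_c0 (fun n => lincomb f (u n)).
Proof.
move=> B0 uB.
have emb_gt0 (c : R) : 0 < c -> 0 < (emb c : S).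
  by move=> c0; rewrite -(@emb0 R k) emb_lt.
exists (emb 4%:R^-1), (emb B); split; [by apply: emb_gt0; rewrite invr_gt0|exact: emb_gt0|].
move=> n x; pose m := \big[Order.max/0]_(i < n) av (x i).
have -> : \big[Order.max/0]_(i < n) `|x i| = emb m.
  rewrite /m (big_morph (emb : R -> S) (op1 := Order.max) (id1 := 0)).
  - by apply: eq_bigr => i _; rewrite /av emb_re.
  - by move=> y z; rewrite /Order.max emb_lt; case: ifP.
  - exact: emb0.
pose P := \sum_(j < n) x j *: u j.
have -> : \sum_(i < n) x i *: lincomb f (u i) = lincomb f P.
  rewrite /P; elim/big_ind2 : _ => [|p v q w -> ->|i _]; first by rewrite lincomb0.
    by rewrite lincombD.
  by rewrite lincombZ.
have -> : `|lincomb f P| = emb (nrm f P) by rewrite /nrm emb_re.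
have m0 : 0 <= m by rewrite bigmax_ge_id.
have xm i : (i < n)%N -> av (x i) <= m.
  by move=> lt_in; exact: (le_bigmax _ (fun i : 'I_n => av (x i)) (Ordinal lt_in)).
rewrite -!embM !emb_le; apply/andP; split.
  rewrite mulrC ler_pdivrMr// mulrC; apply/bigmax_leP; split=> [|i _].
    by rewrite mulr_ge0// nrm_ge0.
  exact: coef_le_comb.
apply: nrm_le => [|t]; first by rewrite mulr_ge0// ltW.
rewrite /P ev_sum (le_trans (av_sum _ _ _))//.
apply: (@le_trans _ _ (\sum_(j < n) m * av (ev f (u j) t))).
  apply: ler_sum => j _; rewrite evZ avM ler_wpM2r ?av_ge0//; exact: xm.
by rewrite -mulr_sumr mulrC ler_wpM2r.
Qed.

End C0.

Theorem theorem6p1 (s : omega1 -> nat -> omega1)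
    (hs : associated_sequences s)
    (R : realType) (k : scalar_kind) (K : metricType R)
    (cK : compact [set: K])
    (f : nat -> CK k cK) (f_norm : normalized_seq f) (f_basic : basic_seq f)
    (M : set nat) (M_inf : infinite_set M)
    (eps : nat -> scalars R k) (eps_gt0 : forall n, 0 < eps n)
    (eps_summable : cvgn (series eps))
    (f_small : forall t : K, finite_set [set n | M n /\ eps n <= `|f n t|]) :
  exists (xi : omega1) (p : nat -> {poly scalars R k}),
    [/\ block_basis p, (forall n, average_of s f xi (p n)) &
        equivalent_c0 (fun n => lincomb f (p n))].
Proof.
have uM := (infinite_unbounded M).1 M_inf.
have [tail [tail_ge0 tailE tail_to0]] := summable_tail eps_gt0 eps_summable.
have [N0 [N0M coef_le take_le2 take_le1]] :=
  basic_selection f_norm eps_gt0 tail_ge0 tailE tail_to0 uM f_small.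
have f_small0 (t : K) : finite_set [set n | N0 n /\ eps n <= `|f n t|].
  by apply: sub_finite_set (f_small t) => n [/N0M.1].
have N0N0 : infsub N0 N0 by apply: infsub_refl; case: N0M.
have [a0 _] : exists a : omega1, True.
  apply: contrapT => /forallNP no; apply: omega1_uncountable.
  rewrite (_ : setT = set0); first exact: countable0.
  by apply/seteqP; split=> // a _; case: (no a).
(* A single ordinal and a single infinite set are stable for all thresholds $1/(i+1)$, hence for
   every positive one. *)
have [||a1 [N1 [_ N1N0 st]]] := @cofinal_countable a0 N0
    (fun i => stable s f (i.+1%:R^-1 : R)) _ _ a0 N0 (lexx _) N0N0.
- by move=> i; exact: stable_upward.
- move=> i; apply: (stable_cofinal hs f_norm coef_le) => // a N NN0 growing.
  have i0 : 0 < i.+1%:R^-1 :> R by rewrite invr_gt0.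
  exact: (not_growing hs f_norm eps_gt0 tail_ge0 tailE tail_to0 coef_le take_le1
    f_small0 i0 NN0 growing).
have stable1 eta : 0 < eta -> stable s f eta a1 N1.
  move=> /natSinv_le[i iP] b a1b N NN1; have [N' N'N gr] := st i b a1b N NN1.
  exists N' => // L LN'; apply: (le_trans (gr L LN')).
  by rewrite lerD2l; exact: iP.
have [L LN1 bd] := absolutely_bounded hs f_norm coef_le take_le2 take_le1 N1N0 stable1.
have LN0 := infsub_trans LN1 N1N0.
have reg := regular_first hs f_norm coef_le a1.
exists a1, (consecutive (first s f a1) L); split.
- exact (block_basis_consecutive reg LN0).
(* Each later block is the first average of the remaining part of [L]. *)
- move=> n; exists (tailset (first s f a1) L n) => //.
  by apply/infinite_unbounded; case: (tailset_infsub0 (first s f a1) n LN0).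
- exact: (equivalent_c0_consecutive reg take_le2 LN0 _ bd).
Qed.
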